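(* The factor algebra $\mathcal{H}_{Q,\kappa}$ is a quantum Drinfeld Hecke algebra if and only if the following four conditions hold: (i) the matrix $Q$ is a quantum system of parameters and $G$ acts on the quantum polynomial algebra $S_Q(V)$ as automorphisms; (ii) the parameter $\kappa$ defines a quantum $2$-form, i.e. $\kappa(v_i,v_i)=0$ for all $i$ and $\kappa(v_i,v_j)=-q_{ji}^{-1}\kappa(v_j,v_i)$ for distinct $i,j$; (iii) for all $h\in G$ and $1\le i<j<k\le n$, the following identity holds in $V$: $$0=\bigl(q_{ik}q_{jk}\,h(v_k)-v_k\bigr)\kappa_h(v_i,v_j)+\bigl(q_{jk}v_j-q_{ij}\,h(v_j)\bigr)\kappa_h(v_i,v_k)+\bigl(h(v_i)-q_{ij}q_{ik}v_i\bigr)\kappa_h(v_j,v_k);$$ (iv) for all $g,h\in G$ and all $1\le i<j\le n$, $$\kappa_{h^{-1}gh}(v_i,v_j)=\sum_{1\le k<\ell\le n}\det{}_{ijk\ell}(h)\,\kappa_g(v_k,v_\ell).$$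
   Context: Let $\mathbb{K}$ be a field of arbitrary characteristic, $V$ a finite-dimensional $\mathbb{K}$-vector space with fixed basis $v_1,\dots,v_n$, and $G\subset \mathrm{GL}(V)$ a finite group. Let $\{t_g: g\in G\}$ be the standard basis of the group algebra $\mathbb{K}G$; the identity of $G$ and the corresponding $t_e$ are identified with $1\in\mathbb{K}$. Let $Q=(q_{ij}: 1\le i,j\le n)$ be a collection of arbitrary nonzero scalars in $\mathbb{K}$ and let $\kappa(v_i,v_j)=\sum_{g\in G}\kappa_g(v_i,v_j)t_g\in\mathbb{K}G$ (with $\kappa_g(v_i,v_j)\in\mathbb{K}$) for $1\le i,j\le n$ be arbitrary. The associative $\mathbb{K}$-algebra $\mathcal{H}_{Q,\kappa}$ is generated by $\{v_1,\dots,v_n\}\cup\{t_g: g\in G\}$ subject to the relations: (a) $t_gt_h=t_{gh}$ for all $g,h\in G$; (b) $t_g v=g(v)t_g$ for all $g\in G$, $v\in V$; (c) $v_jv_i=q_{ij}v_iv_j+\kappa(v_i,v_j)$ for $1\le i,j\le n$. It is called a quantum Drinfeld Hecke algebra if $\{v_1^{\alpha_1}\cdots v_n^{\alpha_n}t_g: \alpha_i\in\mathbb{N}, g\in G\}$ (with $0\in\mathbb{N}$) is a $\mathbb{K}$-basis of $\mathcal{H}_{Q,\kappa}$. $Q$ is a quantum system of parameters if $q_{ii}=1$ and $q_{ij}=q_{ji}^{-1}$ for all $i,j$. The quantum polynomial algebra is $S_Q(V)=\mathbb{K}\langle v_1,\dots,v_n\rangle/\langle v_jv_i-q_{ij}v_iv_j: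 1\le i<j\le n\rangle$. ''$G$ acts on $S_Q(V)$ as automorphisms'' means that the linear action of each $g\in G$ on $V$ extends to an algebra automorphism of $S_Q(V)$. For a linear transformation $h$ of $V$ with $h(v_j)=\sum_i h^j_i v_i$, the quantum $(i,j,k,\ell)$-minor determinant is $\det_{ijk\ell}(h)=h^i_k h^j_\ell-q_{ij}\,h^i_\ell h^j_k$. *)

(* Defs.v *)
From HB Require Import structures.
From mathcomp Require Import all_fingroup.
From mathcomp Require Import all_boot all_order all_algebra generic_quotient.
From mathcomp Require Import boolp.
From mathcomp Require Import monalg.

Set Implicit Arguments.
Unset Strict Implicit.
Unset Printing Implicit Defensive.

Import GRing.Theory.
Local Open Scope ring_scope.
Local Open Scope quotient_scope.

Lemma malg_scalerAr (K : fieldType) (M : monomType) (a : K) (x y : {malg K[M]}) :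
  a *: (x * y) = x * (a *: y).
Proof.
have aC : a%:MP * x = x * a%:MP.
  apply/malgP => k; rewrite mcoeffCM malgM_def fgmulgU raddf_sum /=.
  rewrite {1}[x]monalgE raddf_sum mulr_sumr.
  by apply: eq_bigr => m _; rewrite mulm1 !mcoeffU /= mcoeffU mulrnAr [a * _]mulrC.
by rewrite -[LHS]mul_malgC mulrA aC -mulrA mul_malgC.
Qed.

(* The free associative algebra K<X>: the monoid algebra over K of the free
   monoid on X.  The library only provides its left algebra structure. *)
Definition freealg (K : fieldType) (X : choiceType) : Type :=
  {malg K[{fmonom X}]}.

Section FreeAlgebra.
Variables (K : fieldType) (X : choiceType).

HB.instance Definition _ := GRing.Lalgebra.on (freealg K X).
HB.instance Definition _ :=
  GRing.Lalgebra_isAlgebra.Build K (freealg K X)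
    (@malg_scalerAr K {fmonom X}).

Definition gen (i : X) : freealg K X := mkmalgU (fmu i) 1.

End FreeAlgebra.

Arguments gen K {X} i.

Section QuotientAlgebra.
Variables (K : fieldType) (A : algType K).

Inductive ideal_gen (R : A -> Prop) : A -> Prop :=
| ideal_gen_rel r : R r -> ideal_gen R r
| ideal_gen_0 : ideal_gen R 0
| ideal_gen_add x y : ideal_gen R x -> ideal_gen R y -> ideal_gen R (x + y)
| ideal_gen_mul a x b : ideal_gen R x -> ideal_gen R (a * x * b).

Definition ideal_pred (R : A -> Prop) : {pred A} := fun x => `[< ideal_gen R x >].

Variable R : A -> Prop.

Lemma ideal_pred_zmod : zmod_closed (ideal_pred R).
Proof.
split=> [|x y]; first exact/asboolP/ideal_gen_0.
move=> /asboolP Rx /asboolP Ry; apply/asboolP/ideal_gen_add => //.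
by have := ideal_gen_mul (-1) 1 Ry; rewrite mulN1r mulr1.
Qed.

HB.instance Definition _ := GRing.isZmodClosed.Build A (ideal_pred R) ideal_pred_zmod.

(* This quotient may be the zero algebra, so it cannot be an [algType]: it gets
   a possibly trivial ring structure and a K-module structure; [quotalg_scalerAl]
   and [quotalg_scalerAr] say that they form a K-algebra. *)
Definition quotalg : Type := Quotient.quot (ideal_pred R : zmodClosed A).
HB.instance Definition _ := GRing.Zmodule.on quotalg.

Definition quotmap (x : A) : quotalg := \pi x.

Lemma quotmapK (y : quotalg) : quotmap (repr y) = y.
Proof. exact: reprK. Qed.

Lemma quotmapP x y : quotmap x = quotmap y <-> ideal_gen R (x - y).
Proof.
split=> [/eqP|Rxy]; first by rewrite -Quotient.idealrBE => /asboolP.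
by apply/eqP; rewrite -Quotient.idealrBE; apply/asboolP.
Qed.

Lemma ideal_repr x : ideal_gen R (repr (quotmap x) - x).
Proof. by apply/quotmapP; rewrite quotmapK. Qed.

Lemma quotmap_is_zmod : zmod_morphism quotmap.
Proof.
move=> x y; exact: pi_is_zmod_morphism.
Qed.
HB.instance Definition _ := GRing.isZmodMorphism.Build A quotalg quotmap quotmap_is_zmod.

Definition quot_one : quotalg := quotmap 1.
Definition quot_mul (x y : quotalg) : quotalg := quotmap (repr x * repr y).
Definition quot_scale (a : K) (x : quotalg) : quotalg := quotmap (a *: repr x).

Lemma quot_mulE x y : quot_mul (quotmap x) (quotmap y) = quotmap (x * y).
Proof.
apply/quotmapP.
set x' := repr _; set y' := repr _.
have -> : x' * y' - x * y = 1 * (x' - x) * y' + x * (y' - y) * 1.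
  by rewrite mul1r mulr1 mulrBl mulrBr addrA subrK.
by apply: ideal_gen_add; apply: ideal_gen_mul; apply: ideal_repr.
Qed.

Lemma quot_scaleE a x : quot_scale a (quotmap x) = quotmap (a *: x).
Proof.
apply/quotmapP; rewrite -scalerBr -[_ - _]mul1r scalerAl -[_ * _]mulr1.
exact/ideal_gen_mul/ideal_repr.
Qed.

Lemma quot_mulA : associative quot_mul.
Proof.
by move=> x y z; rewrite -[x]quotmapK -[y]quotmapK -[z]quotmapK !quot_mulE mulrA.
Qed.
Lemma quot_mul1l : left_id quot_one quot_mul.
Proof. by move=> x; rewrite -[x]quotmapK quot_mulE mul1r. Qed.
Lemma quot_mul1r : right_id quot_one quot_mul.
Proof. by move=> x; rewrite -[x]quotmapK quot_mulE mulr1. Qed.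
Lemma quot_mulDl : left_distributive quot_mul +%R.
Proof.
move=> x y z; rewrite -[x]quotmapK -[y]quotmapK -[z]quotmapK.
by rewrite -raddfD !quot_mulE mulrDl raddfD.
Qed.
Lemma quot_mulDr : right_distributive quot_mul +%R.
Proof.
move=> x y z; rewrite -[x]quotmapK -[y]quotmapK -[z]quotmapK.
by rewrite -raddfD !quot_mulE mulrDr raddfD.
Qed.

HB.instance Definition _ := GRing.Zmodule_isPzRing.Build quotalg
  quot_mulA quot_mul1l quot_mul1r quot_mulDl quot_mulDr.

Lemma quot_scaleA a b x : quot_scale a (quot_scale b x) = quot_scale (a * b) x.
Proof. by rewrite -[x]quotmapK !quot_scaleE scalerA. Qed.
Lemma quot_scale1 : left_id 1 quot_scale.
Proof. by move=> x; rewrite -[x]quotmapK quot_scaleE scale1r. Qed.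
Lemma quot_scaleDr : right_distributive quot_scale +%R.
Proof.
move=> a x y; rewrite -[x]quotmapK -[y]quotmapK.
by rewrite -raddfD !quot_scaleE scalerDr raddfD.
Qed.
Lemma quot_scaleDl x : {morph quot_scale^~ x : a b / a + b}.
Proof. by move=> a b; rewrite -[x]quotmapK !quot_scaleE scalerDl raddfD. Qed.

HB.instance Definition _ := GRing.Zmodule_isLmodule.Build K quotalg
  quot_scaleA quot_scale1 quot_scaleDr quot_scaleDl.

Lemma quotmap_is_monoid : monoid_morphism quotmap.
Proof. by split=> // x y; rewrite -quot_mulE. Qed.
HB.instance Definition _ :=
  GRing.isMonoidMorphism.Build A quotalg quotmap quotmap_is_monoid.

Lemma quotmap_is_scalable : scalable quotmap.
Proof. by move=> a x; rewrite -quot_scaleE. Qed.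
HB.instance Definition _ :=
  GRing.isScalable.Build K A quotalg *:%R quotmap quotmap_is_scalable.

Lemma quotalg_scalerAl (a : K) (x y : quotalg) : a *: (x * y) = (a *: x) * y.
Proof.
rewrite -[x]quotmapK -[y]quotmapK.
by rewrite -rmorphM -!linearZ -rmorphM scalerAl.
Qed.
Lemma quotalg_scalerAr (a : K) (x y : quotalg) : a *: (x * y) = x * (a *: y).
Proof.
rewrite -[x]quotmapK -[y]quotmapK.
by rewrite -rmorphM -!linearZ -rmorphM scalerAr.
Qed.

End QuotientAlgebra.

Definition is_basis (K : fieldType) (M : lmodType K) (I : choiceType)
    (b : I -> M) : Prop :=
  (forall (s : seq I) (c : I -> K), uniq s ->
     \sum_(i <- s) c i *: b i = 0 -> {in s, forall i, c i = 0}) /\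
  (forall x : M, exists (s : seq I) (c : I -> K), x = \sum_(i <- s) c i *: b i).

(* A faithful representation is the same thing as a finite subgroup of GL(V)
   indexed by the abstract group [gT]. *)
Definition faithful_rep (K : fieldType) (V : vectType K) (gT : finGroupType)
    (rho : gT -> 'End(V)) : Prop :=
  [/\ rho 1%g = \1%VF,
      forall g h : gT, rho (g * h)%g = (rho g \o rho h)%VF
    & injective rho].

Section QuantumDrinfeldHecke.
Variables (K : fieldType) (V : vectType K) (n : nat) (v : n.-tuple V).
Variables (gT : finGroupType) (rho : gT -> 'End(V)).
Variables (Q : 'M[K]_n).

Inductive qpoly_rel : freealg K 'I_n -> Prop :=
| qpoly_rel_comm (i j : 'I_n) : (i < j)%N ->
    qpoly_rel (gen K j * gen K i - Q i j *: (gen K i * gen K j)).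

Definition qpoly : Type := quotalg qpoly_rel.
HB.instance Definition _ := GRing.PzRing.on qpoly.
HB.instance Definition _ := GRing.Lmodule.on qpoly.

Definition qpoly_vect (u : V) : qpoly :=
  quotmap qpoly_rel (\sum_(i < n) coord v i u *: gen K i).

Definition acts_on_qpoly : Prop :=
  forall g : gT, exists f : {rmorphism qpoly -> qpoly},
    [/\ scalable f, bijective f
      & forall u : V, f (qpoly_vect u) = qpoly_vect (rho g u)].

Definition quantum_system : Prop :=
  (forall i : 'I_n, Q i i = 1) /\ (forall i j : 'I_n, Q i j = (Q j i)^-1).

(* An element of the group algebra KG is given by its coefficient function:
   [kappa i j g] is the coefficient of t_g in kappa(v_i, v_j). *)
Variable kappa : 'I_n -> 'I_n -> {ffun gT -> K}.

Local Notation qdh_free := (freealg K ('I_n + gT)%type).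

Definition free_x (i : 'I_n) : qdh_free := gen K (inl i).
Definition free_t (g : gT) : qdh_free := gen K (inr g).
Definition free_vect (u : V) : qdh_free := \sum_(i < n) coord v i u *: free_x i.
Definition free_kappa (i j : 'I_n) : qdh_free :=
  \sum_(g : gT) kappa i j g *: free_t g.

(* [qdh_rel_one] is the identification of t_e with 1. *)
Inductive qdh_rel : qdh_free -> Prop :=
| qdh_rel_one : qdh_rel (free_t 1%g - 1)
| qdh_rel_group (g h : gT) : qdh_rel (free_t g * free_t h - free_t (g * h)%g)
| qdh_rel_act (g : gT) (u : V) :
    qdh_rel (free_t g * free_vect u - free_vect (rho g u) * free_t g)
| qdh_rel_comm (i j : 'I_n) :
    qdh_rel (free_x j * free_x i - (Q i j *: (free_x i * free_x j) + free_kappa i j)).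

Definition qdh : Type := quotalg qdh_rel.
HB.instance Definition _ := GRing.PzRing.on qdh.
HB.instance Definition _ := GRing.Lmodule.on qdh.

Definition qdh_x (i : 'I_n) : qdh := quotmap qdh_rel (free_x i).
Definition qdh_t (g : gT) : qdh := quotmap qdh_rel (free_t g).

Definition qdh_monomial (m : {ffun 'I_n -> nat} * gT) : qdh :=
  (\prod_(i < n) qdh_x i ^+ m.1 i) * qdh_t m.2.

Definition is_quantum_Drinfeld_Hecke : Prop := is_basis qdh_monomial.

Definition quantum_2form : Prop :=
  (forall i : 'I_n, kappa i i = 0) /\
  (forall i j : 'I_n, i != j ->
     kappa i j = - (Q j i)^-1 *: (kappa j i : {ffun gT -> K^o})).

(* [entry h i j] is $h^j_i$, i.e. h(v_j) = \sum_i entry h i j *: v_i. *)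
Definition entry (h : 'End(V)) (i j : 'I_n) : K := coord v i (h v`_j).

Definition qminor (i j k l : 'I_n) (h : 'End(V)) : K :=
  entry h k i * entry h l j - Q i j * (entry h l i * entry h k j).

End QuantumDrinfeldHecke.

(* Main.v *)
(** The defining relations are read as rewriting rules t_1 -> 1, t_g t_h -> t_gh,
t_g x_i -> g(x_i) t_g and x_j x_i -> q_ij x_i x_j + kappa(v_i, v_j) for i < j,
whose irreducible words are x_1^a_1 ... x_n^a_n t_g (with t_1 omitted).  By
Bergman's diamond lemma they are linearly independent in the quotient as soon
as the overlaps resolve.  The overlaps that involve only letters t, or two
letters t and one x, always resolve; reducing t_h x_j x_i in the two possible
ways gives a difference whose quadratic part vanishes iff h preserves the
relations of S_Q(V) and whose remaining part vanishes iff (iv) holds; for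
x_k x_j x_i the difference is the identity (iii).  These two computations are
made under an arbitrary linear map L compatible with the rules below the
overlap.  With L the normal form map they give confluence; with L the quotient
map they give linear relations between basis monomials, hence the necessity of
the conditions. *)

From Pilot Require Import Defs.
From HB Require Import structures.
From mathcomp Require Import all_fingroup.
From mathcomp Require Import all_boot all_order all_algebra generic_quotient.
From mathcomp Require Import boolp finmap monalg zify ring.

Set Implicit Arguments.
Unset Strict Implicit.
Unset Printing Implicit Defensive.

Import GRing.Theory.
Local Open Scope ring_scope.

(** * Words in the free algebra *)

(** The algebra has relations for all pairs i, j and all vectors u, while a terminating system keeps
    only i < j and basis vectors. Conditions (i) and (ii) close this gap: once q_ij q_ji = 1 and
    [kappa] is a quantum 2-form, the relation for (j, i) is a multiple of that for (i, j), and the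
    one for (i, i) is trivial. Conversely these identities come from no overlap: applying the
    relations for (i, j) and (j, i) in turn leads back to the starting monomial, and a basis admits
    no remainder.

    The quotient may be zero a priori and the normal form map is not multiplicative, so a compatible
    L is only a linear map into a module, and contexts are kept inside the words.

    That G acts on S_Q(V) is a statement about a quotient; turning it into vanishing coefficients
    takes the independence of the x_k x_l, k <= l, in S_Q(V). The relations have no overlaps in
    degree two, so explicit functionals give this for every Q, without a basis of S_Q(V).

    The basis monomials always end in some t_g, whereas irreducible words drop t_1; the two families
    have the same images under every compatible map. *)

Section FreeAlgebraLift.
Variables (K : fieldType) (X : choiceType).
Implicit Types (a b w : seq X) (p q : freealg K X).

(* Locked: otherwise unification unfolds the ring operations of the monoid
   algebra each time it meets a word. *)
Fact word_key : unit. Proof. by []. Qed.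
Definition word : seq X -> freealg K X :=
  locked_with word_key (fun w => mkmalgU (FMonom w) 1).

Lemma wordE w : word w = mkmalgU (FMonom w) 1.
Proof. by rewrite /word unlock. Qed.

Lemma word_nil : word [::] = 1.
Proof. by rewrite wordE -fmoneE. Qed.

Lemma word1 x : word [:: x] = gen K x.
Proof. by rewrite wordE -fmuE. Qed.

Lemma word_cat a b : word (a ++ b) = word a * word b.
Proof.
by rewrite !wordE [RHS]fgmulUU mulr1 -(fmmulE (FMonom a) (FMonom b)).
Qed.

Lemma mcoeff_word w w' : mcoeff (FMonom w) (word w') = (w == w')%:R.
Proof.
by rewrite wordE mcoeffU; congr (_ *+ nat_of_bool _); apply/eqP/eqP => [[->]|->].
Qed.

Lemma freealgE p : p = \sum_(k <- msupp p) mcoeff k p *: word k.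
Proof.
rewrite {1}[p]monalgE; apply: eq_bigr => k _; apply/malgP => k'.
by rewrite mcoeffZ wordE !mcoeffU fmK mulrnAr mulr1.
Qed.

Section Lift.
Variables (M : lmodType K) (f : seq X -> M).

Definition word_lift p : M := \sum_(k <- msupp p) mcoeff k p *: f k.

Lemma word_liftEw (d : {fset {fmonom X}}) p :
  fsubset (msupp p) d -> word_lift p = \sum_(k <- d) mcoeff k p *: f k.
Proof.
move=> le; rewrite [LHS](big_fset_incl _ le) => //= x xd /mcoeff_outdom ->.
by rewrite scale0r.
Qed.

Lemma word_lift_is_linear : linear word_lift.
Proof.
move=> c p q; set d := fsetU (msupp p) (msupp q).
have hp : fsubset (msupp p) d by apply: fsubsetUl.
have hq : fsubset (msupp q) d by apply: fsubsetUr.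
have hpq : fsubset (msupp (c *: p + q)) d.
  by apply: fsubset_trans (msuppD_le _ _) (fsetUSS (msuppZ_le _ _) (fsubset_refl _)).
rewrite (word_liftEw hp) (word_liftEw hq) (word_liftEw hpq) scaler_sumr -big_split /=.
by apply: eq_bigr => k _; rewrite mcoeffD mcoeffZ scalerDl scalerA.
Qed.

HB.instance Definition _ :=
  GRing.isLinear.Build K (freealg K X) M _ word_lift word_lift_is_linear.

Lemma word_lift_word w : word_lift (word w) = f w.
Proof.
rewrite (word_liftEw (d := [fset FMonom w]%fset)) ?wordE ?msuppU1 ?fsubset_refl //.
by rewrite big_seq_fset1 -?wordE mcoeff_word eqxx scale1r.
Qed.

End Lift.

End FreeAlgebraLift.

Arguments word {K X} w.

(** * The diamond lemma *)

Lemma cat_eq_prefix (X : eqType) (u v x y : seq X) : (size u <= size v)%N ->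
  u ++ x = v ++ y -> exists2 c, v = u ++ c & x = c ++ y.
Proof.
elim: u v => [|i u IH] [|j v] //=; first by exists [::].
  by exists (j :: v).
by rewrite ltnS => le_uv [-> /(IH _ le_uv)[c -> ->]]; exists c.
Qed.

Section WordAlgebra.
Variables (K : fieldType) (A : algType K) (X : choiceType) (word : seq X -> A).
Hypothesis word_nil : word [::] = 1.
Hypothesis word_cat : forall a b, word (a ++ b) = word a * word b.
Implicit Types (P : seq X -> Prop) (p q : A).

(** An explicit list of terms: linear maps that agree on the words in [P] then agree on [p], which
    is how inductions on words pass to combinations. *)
Definition word_span P p := exists2 s : seq (K * seq X),
  forall t, t \in s -> P t.2 & p = \sum_(t <- s) t.1 *: word t.2.

Lemma word_span_word P w : P w -> word_span P (word w).
Proof.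
exists [:: (1, w)]; last by rewrite big_seq1 scale1r.
by move=> t; rewrite inE => /eqP ->.
Qed.

Lemma word_span0 P : word_span P 0.
Proof. by exists [::]; rewrite ?big_nil. Qed.

Lemma word_spanD P p q : word_span P p -> word_span P q -> word_span P (p + q).
Proof.
move=> [s hs ->] [s' hs' ->]; exists (s ++ s'); last by rewrite big_cat.
by move=> t; rewrite mem_cat => /orP[/hs|/hs'].
Qed.

Lemma word_spanZ P c p : word_span P p -> word_span P (c *: p).
Proof.
move=> [s hs ->]; exists [seq (c * t.1, t.2) | t <- s].
  by move=> _ /mapP[t ts ->] /=; apply: hs.
by rewrite scaler_sumr big_map; apply: eq_bigr => t _; rewrite scalerA.
Qed.

Lemma word_span_sum P (I : finType) (Q : pred I) (F : I -> A) :
  (forall i, Q i -> word_span P (F i)) -> word_span P (\sum_(i | Q i) F i).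
Proof.
by move=> hF; apply: big_ind => //; [apply: word_span0|apply: word_spanD].
Qed.

Lemma word_span_ctx P P' a b p : (forall w, P w -> P' (a ++ w ++ b)) ->
  word_span P p -> word_span P' (word a * p * word b).
Proof.
move=> hP [s hs ->]; exists [seq (t.1, a ++ t.2 ++ b) | t <- s].
  by move=> _ /mapP[t /hs Pt ->]; apply: hP.
rewrite mulr_sumr mulr_suml big_map; apply: eq_bigr => t _.
by rewrite !word_cat mulrA -scalerAr -scalerAl.
Qed.

Lemma linear_word_span_eq (M : lmodType K) (F G : A -> M) P p :
  linear F -> linear G -> word_span P p ->
  (forall w, P w -> F (word w) = G (word w)) -> F p = G p.
Proof.
move=> linF linG [s hs ->] eqFG.
pose F' := HB.pack_for {linear A -> M} F (GRing.isLinear.Build K A M _ F linF).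
pose G' := HB.pack_for {linear A -> M} G (GRing.isLinear.Build K A M _ G linG).
rewrite -[LHS]/(F' _) -[RHS]/(G' _) !linear_sum.
by apply: eq_big_seq => t ts; rewrite !linearZ /= eqFG //; apply: hs.
Qed.

Section DiamondLemma.
Variable lift : (seq X -> A) -> {linear A -> A}.
Hypothesis lift_word : forall f w, lift f (word w) = f w.
Variable rule : seq X -> A -> Prop.
Variables (lt : seq X -> seq X -> Prop) (weight : seq X -> nat).
Implicit Types (a b l w : seq X) (r : A).

Hypothesis lt_ctx : forall a b u w, lt u w -> lt (a ++ u ++ b) (a ++ w ++ b).
Hypothesis lt_weight : forall u w, lt u w -> (weight u < weight w)%N.
Hypothesis rule_lt : forall l r, rule l r -> word_span (lt^~ l) r.

Definition respects (M : lmodType K) (L : A -> M) (P : seq X -> Prop) :=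
  forall a l r b, rule l r -> P (a ++ l ++ b) ->
    L (word (a ++ l ++ b)) = L (word a * r * word b).

Lemma respects_rule0 (M : lmodType K) (L : {linear A -> M}) P a l r b :
  respects L P -> rule l r -> P (a ++ l ++ b) ->
  L (word a * (word l - r) * word b) = 0.
Proof.
move=> L_rule lr Plr; rewrite mulrBr mulrBl linearB -mulrA -!word_cat.
by rewrite (L_rule _ _ _ _ lr Plr) subrr.
Qed.

(* Relative confluence in Bergman's sense: [p] and [q] agree modulo the
   reductions taking place strictly below [w]. *)
Definition resolvable w p q := forall L : {linear A -> A},
  respects L (lt^~ w) -> L p = L q.

Lemma resolvable_sym w p q : resolvable w p q -> resolvable w q p.
Proof. by move=> h L hL; rewrite h. Qed.

Lemma linear_ctx (M : lmodType K) (L : {linear A -> M}) p q :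
  linear (fun r => L (p * r * q)).
Proof.
move=> c x y; rewrite mulrDr mulrDl linearD -linearZ /=.
by rewrite -scalerAr -scalerAl.
Qed.

(** Precomposing [L] with the context gives again a linear map, and it respects the rules below [w]
    because [lt] is stable under contexts. *)
Lemma resolvable_ctx w p q a b : resolvable w p q ->
  resolvable (a ++ w ++ b) (word a * p * word b) (word a * q * word b).
Proof.
move=> h L hL.
pose Lab := HB.pack_for {linear A -> A}
  (fun r => L (word a * r * word b))
  (GRing.isLinear.Build K A A _ _
     (linear_ctx L (word a) (word b))).
apply: (h Lab) => a' l r b' rlr ltw /=.
have e : a ++ (a' ++ l ++ b') ++ b = (a ++ a') ++ l ++ (b' ++ b).
  by rewrite -!catA.
rewrite -!word_cat -catA e (hL _ _ _ _ rlr); last by rewrite -e; apply: lt_ctx.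
by rewrite !word_cat !mulrA.
Qed.

Hypothesis overlap_resolvable : forall l r l' r' a b,
  rule l r -> rule l' r' -> l ++ b = a ++ l' ->
  a != [::] -> b != [::] -> (size a < size l)%N ->
  resolvable (l ++ b) (r * word b) (word a * r').
Hypothesis inclusion_resolvable : forall l r l' r' a b,
  rule l r -> rule l' r' -> l = a ++ l' ++ b ->
  resolvable l r (word a * r' * word b).

(** Both sides reduce to r d r'. Every word of [r] is below [l], so replacing [l] by it leaves a
    word below the whole one, where [L] may apply the second rule; symmetrically for [r']. *)
Lemma disjoint_resolvable l r l' r' d : rule l r -> rule l' r' ->
  resolvable (l ++ d ++ l') (r * word (d ++ l')) (word (l ++ d) * r').
Proof.
move=> rl rl' L hL.
have linL p q : linear (fun r => L (p * r * q)) by apply: linear_ctx.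
have left : L (1 * r * word (d ++ l')) = L (1 * r * (word d * r')).
  apply: linear_word_span_eq (linL _ _) (linL _ _) (rule_lt rl) _ => k kl.
  rewrite !mul1r -word_cat mulrA -word_cat catA.
  have := hL (k ++ d) l' r' [::] rl'; rewrite cats0 word_nil mulr1 => -> //.
  by rewrite -catA; apply: (lt_ctx [::] (d ++ l') kl).
have right : L (word (l ++ d) * r' * 1) = L (r * word d * r' * 1).
  apply: linear_word_span_eq (linL _ _) (linL _ _) (rule_lt rl') _ => k kl'.
  rewrite !mulr1 -word_cat -mulrA -word_cat -catA.
  have := hL [::] l r (d ++ k) rl; rewrite word_nil mul1r => -> //.
  by have := lt_ctx (l ++ d) [::] kl'; rewrite !cats0 -!catA.
by move: left right; rewrite !mul1r !mulr1 !mulrA => -> ->.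
Qed.

Lemma redexes_resolvable a l r b a' l' r' b' : rule l r -> rule l' r' ->
  a ++ l ++ b = a' ++ l' ++ b' ->
  resolvable (a ++ l ++ b) (word a * r * word b) (word a' * r' * word b').
Proof.
wlog le_aa' : a l r b a' l' r' b' / (size a <= size a')%N.
  move=> wl rl rl' eqw; have [le|/ltnW le] := leqP (size a) (size a').
    exact: wl rl rl' eqw.
  by apply: resolvable_sym; rewrite eqw; apply: wl le rl' rl (esym eqw).
move=> rl rl' /(cat_eq_prefix le_aa')[c -> eqw].
have [le_lc|lt_cl] := leqP (size l) (size c).
  have [d ec eb] := cat_eq_prefix le_lc eqw; rewrite ec eb.
  have := resolvable_ctx (a := a) (b := b') (disjoint_resolvable (d := d) rl rl').
  by rewrite !word_cat !mulrA -!catA.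
have [e el /esym{}eqw] := cat_eq_prefix (ltnW lt_cl) (esym eqw).
have [le_l'e|lt_el'] := leqP (size l') (size e).
  have [f ee ->] := cat_eq_prefix le_l'e (esym eqw); rewrite ee in el.
  have := resolvable_ctx (a := a) (b := b) (inclusion_resolvable rl rl' el).
  by rewrite el !word_cat !mulrA -!catA.
have [f el' ->] := cat_eq_prefix (ltnW lt_el') eqw.
(* With [c] empty the redexes start together and [l] is a proper prefix of [l']: an inclusion with
   the two rules exchanged. *)
have [c0|c_neq0] := eqVneq c [::].
  rewrite c0 /= in el *; rewrite -el in el'.
  have := inclusion_resolvable rl' rl (a := [::]) (b := f) el'.
  move=> /(resolvable_ctx (a := a) (b := b'))/resolvable_sym.
  by rewrite el' word_nil cats0 mul1r !word_cat !mulrA -!catA.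
have f_neq0 : f != [::].
  by apply: contraTneq lt_el' => f0; rewrite el' f0 cats0 ltnn.
have eqlf : l ++ f = c ++ l' by rewrite el el' catA.
have := overlap_resolvable rl rl' eqlf c_neq0 f_neq0 lt_cl.
move=> /(resolvable_ctx (a := a) (b := b')).
by rewrite !word_cat !mulrA -!catA.
Qed.

Definition reducible w :=
  exists t : seq X * seq X * A * seq X,
    rule t.1.1.2 t.1.2 /\ w = t.1.1.1 ++ t.1.1.2 ++ t.2.

Definition step w : option A :=
  if pselect (reducible w) is left h then
    let t := projT1 (cid h) in Some (word t.1.1.1 * t.1.2 * word t.2)
  else None.

Lemma stepP w p : step w = Some p -> exists a l r b,
  [/\ rule l r, w = a ++ l ++ b & p = word a * r * word b].
Proof.
rewrite /step; case: pselect => // h [<-].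
case: (cid h) => -[[[a l] r] b] /= [rl ->].
by exists a, l, r, b.
Qed.

Lemma step_None w : step w = None <-> ~ reducible w.
Proof. by rewrite /step; case: pselect. Qed.

Lemma step_weight w p :
  step w = Some p -> word_span (fun k => weight k < weight w)%N p.
Proof.
move=> /stepP[a [l [r [b [rl -> ->]]]]].
by apply: word_span_ctx (rule_lt rl) => k /lt_ctx/lt_weight.
Qed.

(** [d] is fuel. Each step lowers the weight, so any [d] above the weight of [w] gives the same
    value and the default at [d = 0] does not affect it. *)
Fixpoint normal_iter d w : A :=
  if d is d'.+1 then
    if step w is Some p then lift (normal_iter d') p else word w
  else word w.

Lemma normal_iter_stable d d' w : (weight w < d)%N -> (weight w < d')%N ->
  normal_iter d w = normal_iter d' w.
Proof.
elim: d d' w => // d IH [|d'] w //=; rewrite !ltnS => le_wd le_wd'.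
case sw: (step w) => [p|] //.
apply: linear_word_span_eq (linearP _) (linearP _) (step_weight sw) _ => k ltkw.
by rewrite !lift_word; apply: IH; apply: leq_trans ltkw _.
Qed.

Definition normal_form : {linear A -> A} :=
  lift (fun w => normal_iter (weight w).+1 w).

Lemma normal_form_step w p :
  step w = Some p -> normal_form (word w) = normal_form p.
Proof.
move=> sw; rewrite /normal_form lift_word [LHS]/= sw.
apply: linear_word_span_eq (linearP _) (linearP _) (step_weight sw) _ => k ltkw.
by rewrite !lift_word; apply: normal_iter_stable.
Qed.

Lemma normal_form_irreducible w : ~ reducible w -> normal_form (word w) = word w.
Proof. by move=> /step_None sw; rewrite /normal_form lift_word /= sw. Qed.

(** By induction on the weight: the normal form follows the redex chosen by [step], any other redex
    is compared with it by [redexes_resolvable], and the compatibility below the word required there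
    is the induction hypothesis. *)
Theorem diamond_lemma : respects normal_form xpredT.
Proof.
move=> a l r b rl _; have [d] := ubnP (weight (a ++ l ++ b)).
elim: d => // d IH in a l r b rl *; rewrite ltnS => le_wd.
case sw: (step (a ++ l ++ b)) => [p|]; last first.
  by case/step_None: sw; exists (a, l, r, b).
rewrite (normal_form_step sw).
have [a' [l' [r' [b' [rl' eqw ->]]]]] := stepP sw.
apply: (resolvable_sym (redexes_resolvable rl rl' eqw)).
move=> a1 l1 r1 b1 rl1 lt1; apply: IH => //.
exact: leq_trans (lt_weight lt1) le_wd.
Qed.

End DiamondLemma.
End WordAlgebra.

(** * Rewriting rules and their overlaps *)

Section Straightening.
Variables (K : fieldType) (n : nat) (M : lmodType K) (Q c : 'I_n -> 'I_n -> K).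

(* Note the order of the indices: [c k l] is the coefficient of x_l x_k, and
   [straight_coef k l] that of x_k x_l (k <= l) after straightening. *)
Definition straight_coef (k l : 'I_n) : K :=
  if k == l then c k k else c k l * Q k l + c l k.

Lemma sum_ord_trichotomy (F : 'I_n -> 'I_n -> M) :
  \sum_k \sum_l F k l =
  \sum_k (F k k + \sum_(l < n | (k < l)%N) (F k l + F l k)).
Proof.
under [RHS]eq_bigr do rewrite big_split addrCA /=.
rewrite !big_split /= [X in _ = _ + (_ + X)](exchange_big_dep xpredT) //=.
rewrite -!big_split /=; apply: eq_bigr => k _.
rewrite (bigID (fun l : 'I_n => k < l)%N) /=; congr (_ + _).
rewrite (bigD1 k) ?ltnn //=; congr (_ + _); apply: eq_bigl => l.
by rewrite -leqNgt -val_eqE ltn_neqAle andbC.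
Qed.

(** [e] is what straightening leaves behind: the [kappa] terms in the Hecke algebra, zero in S_Q(V).
    The same quadratic coefficients thus occur in both. *)
Lemma sum_straighten (P e : 'I_n -> 'I_n -> M) :
  (forall k l : 'I_n, (k < l)%N -> P l k = Q k l *: P k l + e k l) ->
  \sum_k \sum_l c k l *: P l k =
  \sum_(k < n) \sum_(l < n | (k <= l)%N) straight_coef k l *: P k l +
  \sum_(k < n) \sum_(l < n | (k < l)%N) c k l *: e k l.
Proof.
move=> hP; rewrite sum_ord_trichotomy -big_split /=; apply: eq_bigr => k _.
rewrite [X in _ = X + _](bigD1 k) //= {1}/straight_coef eqxx -addrA.
have lekl (l : 'I_n) : (k <= l)%N && (l != k) = (k < l)%N.
  by rewrite ltn_neqAle andbC [l == k]eq_sym.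
congr (_ + _); rewrite (eq_bigl _ _ lekl).
rewrite -big_split /=; apply: eq_bigr => l ltkl.
have /negPf kl : k != l by rewrite neq_ltn ltkl.
by rewrite hP // /straight_coef kl scalerDl scalerDr scalerA addrAC.
Qed.

End Straightening.

(** * The rewriting system and its termination *)

Section Rules.
Variables (K : fieldType) (n : nat) (gT : finGroupType).
Variables (E : gT -> 'I_n -> 'I_n -> K) (Q : 'I_n -> 'I_n -> K).
Variable kappa : 'I_n -> 'I_n -> gT -> K.
Variables (A : algType K) (word : seq ('I_n + gT) -> A).
Hypothesis word_nil : word [::] = 1.
Hypothesis word_cat : forall a b, word (a ++ b) = word a * word b.

Local Notation letter := ('I_n + gT)%type.
Local Notation X i := (inl i : letter).
Local Notation T g := (inr g : letter).
Implicit Types (a b u w : seq letter) (i j k l : 'I_n) (g h : gT).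

Inductive pbw_rule : seq letter -> A -> Prop :=
| rule_one : pbw_rule [:: T 1%g] 1
| rule_mul g h : pbw_rule [:: T g; T h] (word [:: T (g * h)%g])
| rule_act g i :
    pbw_rule [:: T g; X i] (\sum_k E g k i *: word [:: X k; T g])
| rule_comm i j : (i < j)%N ->
    pbw_rule [:: X j; X i]
      (Q i j *: word [:: X i; X j] + \sum_g kappa i j g *: word [:: T g]).

(** Put c_i = 2n + 2 - i. Then x_j x_i exceeds x_i x_j by c_i - c_j = j - i, and t_g x_i exceeds x_k
    t_g by 2 c_i - c_k - 1, which is positive because all c lie between n + 3 and 2n + 2. *)
Definition eval_letter (x : letter) (z : nat) : nat :=
  match x with inl i => (2 * z + (2 * n + 2 - i))%N | inr _ => (2 * z + 1)%N end.

Definition eval_word w (z : nat) : nat := foldr eval_letter z w.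

(* Letters act on nat as affine maps; the slopes and constants are chosen so
   that each rule decreases the composite pointwise, and a comparison of
   monotone maps is automatically compatible with concatenation. *)
Definition word_lt u w : Prop := forall z, (eval_word u z < eval_word w z)%N.

Lemma eval_word_cat a b z : eval_word (a ++ b) z = eval_word a (eval_word b z).
Proof. by rewrite /eval_word foldr_cat. Qed.

Lemma eval_word_mono a y z : (y < z)%N -> (eval_word a y < eval_word a z)%N.
Proof. by elim: a => //= -[i|g] a IH /IH /=; lia. Qed.

Lemma word_lt_ctx a b u w : word_lt u w -> word_lt (a ++ u ++ b) (a ++ w ++ b).
Proof.
by move=> lt_uw z; rewrite !eval_word_cat; apply/eval_word_mono/lt_uw.
Qed.


Lemma pbw_rule_lt (l : seq letter) r : pbw_rule l r -> word_span word (word_lt^~ l) r.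
Proof.
case=> [|g h|g i|i j ltij].
- by rewrite -word_nil; apply: word_span_word => z /=; lia.
- by apply: word_span_word => z /=; lia.
- apply: word_span_sum => k _; apply/word_spanZ/word_span_word => z /=.
  by have := ltn_ord i; have := ltn_ord k; lia.
- apply: word_spanD; last first.
    apply: word_span_sum => g _; apply/word_spanZ/word_span_word => z /=.
    by have := ltn_ord i; have := ltn_ord j; lia.
  apply/word_spanZ/word_span_word => z /=.
  by have := ltn_ord i; have := ltn_ord j; lia.
Qed.

Section Respectful.
Variables (M : lmodType K) (L : {linear A -> M}) (P : seq letter -> Prop).
Hypothesis LP : respects word pbw_rule L P.

Lemma respects_one a b : P (a ++ T 1%g :: b) ->
  L (word (a ++ T 1%g :: b)) = L (word (a ++ b)).
Proof.
by move=> /(@LP a _ _ b rule_one) ->; rewrite mulr1 -word_cat.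
Qed.

Lemma respects_mul a g h b : P (a ++ [:: T g, T h & b]) ->
  L (word (a ++ [:: T g, T h & b])) = L (word (a ++ T (g * h)%g :: b)).
Proof.
by move=> /(@LP a _ _ b (rule_mul g h)) ->; rewrite -!word_cat -catA.
Qed.

Lemma respects_act a g i b : P (a ++ [:: T g, X i & b]) ->
  L (word (a ++ [:: T g, X i & b])) =
  \sum_k E g k i *: L (word (a ++ [:: X k, T g & b])).
Proof.
move=> /(@LP a _ _ b (rule_act g i)) ->.
rewrite mulr_sumr mulr_suml linear_sum; apply: eq_bigr => k _.
by rewrite -scalerAr -scalerAl linearZ /= -!word_cat -catA.
Qed.

Lemma respects_comm a i j b : (i < j)%N -> P (a ++ [:: X j, X i & b]) ->
  L (word (a ++ [:: X j, X i & b])) =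
  Q i j *: L (word (a ++ [:: X i, X j & b])) +
  \sum_g kappa i j g *: L (word (a ++ T g :: b)).
Proof.
move=> ltij /(@LP a _ _ b (rule_comm ltij)) ->.
rewrite mulrDr mulrDl linearD; congr (_ + _).
  by rewrite -scalerAr -scalerAl linearZ /= -!word_cat -catA.
rewrite mulr_sumr mulr_suml linear_sum; apply: eq_bigr => k _.
by rewrite -scalerAr -scalerAl linearZ /= -!word_cat -catA.
Qed.

End Respectful.

(** For [E] the matrix entries of the representation this is [qminor] by computation, so condition
    (iv) needs no translation. *)
Definition minor h i j k l : K :=
  E h k i * E h l j - Q i j * (E h l i * E h k j).

(* The v_l-coordinate of the identity in condition (iii), at the group element g. *)
Definition jacobi_coef g i j k l : K :=
  kappa i j g * (Q i k * Q j k * E g l k - (l == k)%:R) +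
  kappa i k g * (Q j k * (l == j)%:R - Q i j * E g l j) +
  kappa j k g * (E g l i - Q i j * Q i k * (l == i)%:R).

(** * The overlaps t_h x_j x_i and x_k x_j x_i *)

Section Overlaps.
Variables (M : lmodType K) (L : {linear A -> M}).
Local Notation respects_below w :=
  (respects word pbw_rule L (word_lt^~ w)).

Lemma overlap_act_comm h i j : (i < j)%N ->
  respects_below [:: T h; X j; X i] ->
  L ((\sum_l E h l j *: word [:: X l; T h]) * word [:: X i]) -
  L (word [:: T h] * (Q i j *: word [:: X i; X j] +
                      \sum_g kappa i j g *: word [:: T g])) =
  \sum_(k < n) \sum_(l < n | (k <= l)%N)
    straight_coef Q (minor h i j) k l *: L (word [:: X k; X l; T h]) +
  \sum_g ((\sum_(k < n) \sum_(l < n | (k < l)%N) minor h i j k l * kappa k l g)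
           - kappa i j (h^-1 * g * h)%g) *: L (word [:: T (g * h)%g]).
Proof.
move=> ltij hL.
have -> : L ((\sum_l E h l j *: word [:: X l; T h]) * word [:: X i]) =
    \sum_k \sum_l (E h l j * E h k i) *: L (word [:: X l; X k; T h]).
  rewrite mulr_suml linear_sum exchange_big; apply: eq_bigr => k _.
  rewrite -scalerAl linearZ -word_cat /=.
  rewrite (respects_act hL (a := [:: X k]) (b := [::])) /=; last first.
    by move=> z /=; have := ltn_ord i; have := ltn_ord j; have := ltn_ord k; lia.
  by rewrite scaler_sumr; apply: eq_bigr => l _; rewrite scalerA.
have -> : L (word [:: T h] * (Q i j *: word [:: X i; X j] +
                      \sum_g kappa i j g *: word [:: T g])) =
    \sum_k \sum_l (Q i j * (E h l i * E h k j)) *: L (word [:: X l; X k; T h])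
    + \sum_g kappa i j (h^-1 * g * h)%g *: L (word [:: T (g * h)%g]).
  rewrite mulrDr linearD -scalerAr linearZ -word_cat /=; congr (_ + _).
    rewrite (respects_act hL (a := [::]) (b := [:: X j])) /=; last first.
      by move=> z /=; have := ltn_ord i; have := ltn_ord j; lia.
    rewrite scaler_sumr exchange_big; apply: eq_bigr => k _.
    rewrite (respects_act hL (a := [:: X k]) (b := [::])) /=; last first.
      by move=> z /=; have := ltn_ord i; have := ltn_ord j; have := ltn_ord k; lia.
    by rewrite !scaler_sumr; apply: eq_bigr => l _; rewrite !scalerA mulrA.
  (* Replacing g by h^-1 g h turns t_h t_g into t_(gh), the form in which the other side produces
     its [kappa] terms when x_l x_k t_h is straightened. *)
  rewrite mulr_sumr linear_sum (reindex_inj (conjg_inj h)) /=.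
  apply: eq_bigr => g _; rewrite -scalerAr linearZ /= -word_cat /= conjgE mulgA.
  rewrite (respects_mul hL (a := [::]) (b := [::])) /= ?mulgA ?mulgV ?mul1g //.
  by move=> z /=; have := ltn_ord i; have := ltn_ord j; lia.
rewrite opprD addrA -sumrB.
under eq_bigr do rewrite -sumrB.
under eq_bigr do under eq_bigr do rewrite -scalerBl -/(minor h i j _ _).
have strP (k l : 'I_n) : (k < l)%N -> L (word [:: X l; X k; T h]) =
    Q k l *: L (word [:: X k; X l; T h]) +
    \sum_g kappa k l g *: L (word [:: T (g * h)%g]).
  move=> ltkl; rewrite (respects_comm hL (a := [::]) (b := [:: T h]) ltkl) /=.
    congr (_ + _); apply: eq_bigr => g _.
    rewrite (respects_mul hL (a := [::]) (b := [::])) //.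
    by move=> z /=; have := ltn_ord i; have := ltn_ord j; lia.
  move=> z /=; have := ltn_ord i; have := ltn_ord j.
  by have := ltn_ord k; have := ltn_ord l; lia.
under eq_bigr do under eq_bigr do rewrite [E h _ j * _]mulrC.
rewrite (sum_straighten (P := fun l k => L (word [:: X l; X k; T h])) _ strP).
rewrite -addrA; congr (_ + _).
under [RHS]eq_bigr do rewrite scalerBl.
rewrite sumrB; congr (_ - _).
under [RHS]eq_bigr do rewrite scaler_suml.
rewrite [RHS]exchange_big; apply: eq_bigr => k _.
under [RHS]eq_bigr do rewrite scaler_suml.
rewrite [RHS]exchange_big; apply: eq_bigr => l _.
by rewrite scaler_sumr; apply: eq_bigr => g _; rewrite scalerA.
Qed.

Lemma overlap_comm_comm i j k : (i < j)%N -> (j < k)%N ->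
  respects_below [:: X k; X j; X i] ->
  L ((Q j k *: word [:: X j; X k] + \sum_g kappa j k g *: word [:: T g])
      * word [:: X i]) -
  L (word [:: X k] * (Q i j *: word [:: X i; X j] +
                      \sum_g kappa i j g *: word [:: T g])) =
  \sum_g \sum_l jacobi_coef g i j k l *: L (word [:: X l; T g]).
Proof.
move=> ltij ltjk hL; have ltik := ltn_trans ltij ltjk.
have [lei lej lek] := And3 (ltn_ord i) (ltn_ord j) (ltn_ord k).
pose S (a b c : 'I_n) := L (word [:: X a; X b; X c]).
pose XT (a b c : 'I_n) := \sum_g kappa b c g *: L (word [:: X a; T g]).
pose TX (b c a : 'I_n) :=
  \sum_g kappa b c g *: (\sum_l E g l a *: L (word [:: X l; T g])).
have TXE (b c a : 'I_n) : 
    \sum_g kappa b c g *: L (word [:: T g; X a]) = TX b c a.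
  apply: eq_bigr => g _; rewrite (respects_act hL (a := [::]) (b := [::])) //=.
  by move=> z /=; have := ltn_ord a; lia.
have jki : S j k i = Q i k *: S j i k + XT j i k.
  by rewrite /S (respects_comm hL (a := [:: X j]) (b := [::]) ltik) // => z /=; lia.
have jik : S j i k = Q i j *: S i j k + TX i j k.
  rewrite -TXE /S (respects_comm hL (a := [::]) (b := [:: X k]) ltij) // => z /=.
  lia.
have kij : S k i j = Q i k *: S i k j + TX i k j.
  rewrite -TXE /S (respects_comm hL (a := [::]) (b := [:: X j]) ltik) // => z /=.
  lia.
have ikj : S i k j = Q j k *: S i j k + XT i j k.
  by rewrite /S (respects_comm hL (a := [:: X i]) (b := [::]) ltjk) // => z /=; lia.
have -> : L ((Q j k *: word [:: X j; X k] + \sum_g kappa j k g *: word [:: T g])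
      * word [:: X i]) = Q j k *: S j k i + TX j k i.
  rewrite mulrDl linearD -scalerAl linearZ /= -word_cat -TXE mulr_suml linear_sum.
  congr (_ + _); apply: eq_bigr => g _.
  by rewrite -scalerAl linearZ /= -word_cat.
have -> : L (word [:: X k] * (Q i j *: word [:: X i; X j] +
      \sum_g kappa i j g *: word [:: T g])) = Q i j *: S k i j + XT k i j.
  rewrite mulrDr linearD -scalerAr linearZ /= -word_cat mulr_sumr linear_sum.
  congr (_ + _); apply: eq_bigr => g _.
  by rewrite -scalerAr linearZ /= -word_cat.
rewrite jki jik kij ikj.
have -> : \sum_g \sum_l jacobi_coef g i j k l *: L (word [:: X l; T g]) =
    ((Q i k * Q j k) *: TX i j k - XT k i j) +
    (Q j k *: XT j i k - Q i j *: TX i k j) +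
    (TX j k i - (Q i j * Q i k) *: XT i j k).
  rewrite /TX /XT !scaler_sumr -!sumrB -!big_split /=; apply: eq_bigr => g _.
  pose F (l : 'I_n) := L (word [:: X l; T g]).
  have FE (a : 'I_n) : L (word [:: X a; T g]) = \sum_l (l == a)%:R *: F l.
    rewrite (bigD1 a) //= eqxx scale1r big1 ?addr0 // => l /negPf ->.
    by rewrite scale0r.
  rewrite !FE !scaler_sumr -!sumrB -!big_split /=; apply: eq_bigr => l _.
  rewrite !scalerA -!scalerBl -!scalerDl; congr (_ *: _).
  by rewrite /jacobi_coef; ring.
rewrite !scalerDr !scalerA !opprD.
(* Terms 1 and 5 are the two multiples of x_i x_j x_k, which cancel. The other six are paired by the
   [kappa] they carry: that of (i, j), of (i, k), of (j, k), as in condition (iii). *)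
rewrite [LHS](AC (4*4) (1*5*(2*8*(3*7)*(4*6)))) /=.
have -> : Q j k * Q i k * Q i j = Q i j * Q i k * Q j k by ring.
by rewrite subrr add0r [Q i k * _]mulrC.
Qed.

End Overlaps.

(** * Resolving all ambiguities *)

Section Confluence.
Hypothesis E1 : forall k i, E 1%g k i = (k == i)%:R.
Hypothesis EM : forall g h l i, E (g * h)%g l i = \sum_k E g l k * E h k i.
Hypothesis straight0 : forall h i j, (i < j)%N ->
  forall k l, (k <= l)%N -> straight_coef Q (minor h i j) k l = 0.
Hypothesis kappaJ : forall g h i j, (i < j)%N -> kappa i j (h^-1 * g * h)%g =
  \sum_(k < n) \sum_(l < n | (k < l)%N) minor h i j k l * kappa k l g.
Hypothesis jacobi0 : forall g i j k, (i < j)%N -> (j < k)%N ->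
  forall l, jacobi_coef g i j k l = 0.

(** Left-hand sides have at most two letters, so a proper overlap shares one letter and has the
    shape ttt, ttx, txx or xxx. The first resolves by associativity in G, the second by [EM], the
    third by [straight0] and [kappaJ], the last by [jacobi0]. *)
Lemma pbw_rule_overlap u r u' r' a b :
  pbw_rule u r -> pbw_rule u' r' -> u ++ b = a ++ u' ->
  a != [::] -> b != [::] -> (size a < size u)%N ->
  resolvable word pbw_rule word_lt (u ++ b) (r * word b) (word a * r').
Proof.
case: a => // x a rl rl' eqw _ + /=.
case: rl eqw => [|g h|g i|i j ltij]; case: a => // -[ex]; rewrite -{x}ex;
  case: rl' => [|g' h'|g' i'|i' j' ltij'] [] //; try by move=> _ ->.
- move=> -> -> _ _ L hL; rewrite -!word_cat /=.
  rewrite (respects_mul hL (a := [::]) (b := [::])) /=; last by move=> z /=; lia.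
  rewrite (respects_mul hL (a := [::]) (b := [::])) /=; last by move=> z /=; lia.
  by rewrite mulgA.
- move=> -> -> _ _ L hL; rewrite -!word_cat /=.
  rewrite (respects_act hL (a := [::]) (b := [::])) /=; last by move=> z /=; lia.
  rewrite mulr_sumr linear_sum.
  under [RHS]eq_bigr => k _.
    rewrite -scalerAr linearZ -word_cat /=.
    rewrite (respects_act hL (a := [::]) (b := [:: _])) /=; last first.
      by move=> z /=; have := ltn_ord k; have := ltn_ord i'; lia.
    rewrite scaler_sumr; under eq_bigr => l0 _.
      rewrite (respects_mul hL (a := [:: _]) (b := [::])) /= ?scalerA; last first.
        by move=> z /=; have := ltn_ord l0; have := ltn_ord i'; lia.
      rewrite mulrC; over.
    over.
  rewrite exchange_big; apply: eq_bigr => l0 _ /=.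
  by rewrite EM scaler_suml.
- move=> -> -> _ _ L hL; apply/eqP; rewrite -subr_eq0; apply/eqP.
  rewrite overlap_act_comm // big1 ?add0r => [|k _]; last first.
    by apply: big1 => l0 lekl; rewrite straight0 // scale0r.
  by apply: big1 => k _; rewrite -kappaJ // subrr scale0r.
- move=> ei; rewrite ei in ltij *; move=> -> _ _ L hL.
  apply/eqP; rewrite -subr_eq0; apply/eqP.
  rewrite overlap_comm_comm // big1 // => g _; apply: big1 => l0 _.
  by rewrite jacobi0 // scale0r.
Qed.

(** Apart from a rule meeting itself, the only inclusions are those of t_1 in t_1 t_h, t_g t_1 and
    t_1 x_i; the last one uses [E1]. *)
Lemma pbw_rule_inclusion u r u' r' a b :
  pbw_rule u r -> pbw_rule u' r' -> u = a ++ u' ++ b ->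
  resolvable word pbw_rule word_lt u r (word a * r' * word b).
Proof.
case=> [|g h|g i|i j ltij]; case=> [|g' h'|g' i'|i' j' ltij'];
  case: a => [|x [|y [|z a]]] //; case: b => [|x' [|y' b]] //;
  rewrite ?word_nil ?mul1r ?mulr1 //.
- by case=> -> <- L _; rewrite mul1g.
- by case=> <- -> L _; rewrite mulg1.
- by case=> -> -> L _.
- case=> -> <- L hL; rewrite linear_sum (bigD1 i) //= big1 ?addr0 => [|k /negPf ki].
    rewrite linearZ /= E1 eqxx scale1r.
    rewrite (respects_one hL (a := [:: _]) (b := [::])) // => z /=.
    by have := ltn_ord i; lia.
  by rewrite linearZ /= E1 ki scale0r.
- by case=> -> -> L _.
- by case=> -> -> L _.
Qed.

Theorem pbw_normal_form (lift : (seq letter -> A) -> {linear A -> A}) :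
  (forall f w, lift f (word w) = f w) ->
  exists2 N : {linear A -> A}, respects word pbw_rule N xpredT &
    forall w, ~ reducible pbw_rule w -> N (word w) = word w.
Proof.
move=> lift_word.
exists (normal_form word lift pbw_rule (fun w => eval_word w 0)).
  apply: (diamond_lemma word_nil word_cat lift_word word_lt_ctx) => //.
  - exact: pbw_rule_lt.
  - exact: pbw_rule_overlap.
  - exact: pbw_rule_inclusion.
by move=> w; apply: normal_form_irreducible.
Qed.

End Confluence.

End Rules.

(** * Irreducible words *)

Section NormalWords.
Variables (n : nat) (gT : finGroupType).
Local Notation letter := ('I_n + gT)%type.
Local Notation X i := (inl i : letter).
Local Notation T g := (inr g : letter).
Implicit Types (w : seq letter) (m : {ffun 'I_n -> nat}) (g : gT).

Definition ord_le (i j : 'I_n) : bool := (i <= j)%N.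

Definition sorted_seq m : seq 'I_n := flatten [seq nseq (m i) i | i <- enum 'I_n].

Lemma count_sorted_seq m i : count_mem i (sorted_seq m) = m i.
Proof.
rewrite count_flatten -map_comp sumnE big_map big_enum /= (bigD1 i) //=.
rewrite count_nseq /= eqxx mul1n big1 ?addn0 // => j /negPf ji.
by rewrite count_nseq /= ji.
Qed.

Lemma sorted_sorted_seq m : sorted ord_le (sorted_seq m).
Proof.
have ord_le_tr : transitive ord_le by move=> j i k; apply: leq_trans.
rewrite sorted_pairwise // /sorted_seq.
have: pairwise ord_le (enum 'I_n).
  rewrite -sorted_pairwise // -(map_id (enum 'I_n)).
  have := iota_sorted 0 n; rewrite -val_enum_ord sorted_map.
  by rewrite map_id.
elim: (enum 'I_n) => //= i s IH /andP[/allP le_is /IH{}IH].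
rewrite pairwise_cat IH andbT; apply/andP; split.
  apply/allrelP => j k /nseqP[-> _] /flattenP[_ /mapP[l ls ->]] /nseqP[-> _].
  exact: le_is.
elim: (m i) => //= d ->; rewrite andbT; apply/allP => j /nseqP[-> _].
exact: leqnn.
Qed.

Lemma sorted_seq_count s :
  sorted ord_le s -> s = sorted_seq [ffun i => count_mem i s].
Proof.
move=> sorted_s; apply: (@sorted_eq _ ord_le) => //.
- by move=> j i k; apply: leq_trans.
- by move=> i j; rewrite /ord_le -eqn_leq => /eqP/val_inj.
- exact: sorted_sorted_seq.
- by apply/permP => p; apply/permP: p; apply/allP => i _ /=;
    rewrite count_sorted_seq ffunE.
Qed.

Definition normal_word m g : seq letter :=
  map inl (sorted_seq m) ++ (if g == 1%g then [::] else [:: T g]).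

Lemma normal_word_inj m m' g g' :
  normal_word m g = normal_word m' g' -> (m, g) = (m', g').
Proof.
move=> e; congr (_, _).
  apply/ffunP => i; have := congr1 (count_mem (X i)) e.
  rewrite /normal_word !count_cat !count_map /=.
  have c s : count (preim inl (pred1 (X i))) s = count_mem i s.
    by apply: eq_count => j /=.
  by rewrite !c !count_sorted_seq; do 2!case: ifP => _ /=; rewrite !addn0.
have mem_T h k p : (T h \in normal_word p k) = (h == k) && (k != 1%g).
  rewrite mem_cat; have /negPf -> : T h \notin map inl (sorted_seq p).
    by apply/mapP => -[].
  by case: eqVneq => //=; rewrite ?inE ?andbF ?andbT.
have [g1|g1] := eqVneq g 1%g; have [g1'|g1'] := eqVneq g' 1%g.
- by rewrite g1 g1'.
- by have := mem_T g' g' m'; rewrite -e mem_T eqxx g1 g1' eqxx andbF.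
- by have := mem_T g g m; rewrite e mem_T eqxx g1 g1' eqxx andbF.
- by have := mem_T g g m; rewrite e mem_T eqxx g1 g1' andbT => /eqP.
Qed.

(** Not an order: it says that [[:: x; y]] is not the left-hand side of a rule. A letter t followed
    by anything always reduces, hence the constant [false]. *)
Definition letter_le (x y : letter) : bool :=
  match x, y with
  | inl i, inl j => (i <= j)%N
  | inl _, inr _ => true
  | inr _, _ => false
  end.

Definition irreducible_word w := sorted letter_le w && (T 1%g \notin w).

Lemma irreducible_normal_word m g : irreducible_word (normal_word m g).
Proof.
rewrite /irreducible_word /normal_word mem_cat negb_or; apply/andP; split.
  have : sorted letter_le (map inl (sorted_seq m)).
    by rewrite sorted_map; apply: sorted_sorted_seq.
  case: ifP => _; rewrite ?cats0 // cats1.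
  case: (sorted_seq m) => //= i s pis; rewrite rcons_path pis /=.
  by rewrite last_map.
apply/andP; split; first by apply/mapP => -[].
by case: eqVneq => // g1; rewrite inE eq_sym; apply: contra g1 => /eqP[->].
Qed.

Lemma irreducible_wordE w :
  irreducible_word w -> exists m g, w = normal_word m g.
Proof.
rewrite /irreducible_word => /andP[sorted_w T1].
have [s [t [ew sorted_s]]] : exists s t,
    w = map inl s ++ (if t is Some g then [:: T g] else [::]) /\ sorted ord_le s.
  elim: w sorted_w {T1} => [|x w IH] /=; first by exists [::], None.
  case: w IH => [|y w] IH /=.
    by case: x => [i|g] _; [exists [:: i], None|exists [::], (Some g)].
  move=> /andP[le_xy /IH[s [t [e sorted_s]]]].
  case: x le_xy => // i le_iy; exists (i :: s), t; split; first by rewrite e.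
  by case: s e sorted_s => [|j s] //= [ey _] ->; rewrite andbT; rewrite ey in le_iy.
exists [ffun i => count_mem i s], (odflt 1%g t).
rewrite /normal_word -sorted_seq_count // ew; congr (_ ++ _).
case: t ew => [g|] ew /=; last by rewrite eqxx.
by case: eqVneq => // g1; rewrite ew g1 mem_cat inE eqxx orbT in T1.
Qed.

Section Rule.
Variables (K : fieldType) (E : gT -> 'I_n -> 'I_n -> K) (Q : 'I_n -> 'I_n -> K).
Variable kappa : 'I_n -> 'I_n -> gT -> K.
Variables (A : algType K) (word : seq letter -> A).
Local Notation pbw_rule := (pbw_rule E Q kappa word).

Lemma irreducible_wordP w : irreducible_word w <-> ~ reducible pbw_rule w.
Proof.
split=> [/andP[sorted_w T1]|irr_w].
  case=> -[[[a l] r] b] /= [rl ew]; move: sorted_w T1; rewrite ew.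
  move=> /cat_sorted2[_ /cat_sorted2[sorted_l _]].
  rewrite !mem_cat !negb_or => /and3P[_ T1 _].
  case: rl sorted_l T1 {ew} => //= [|i j ltij]; first by rewrite inE eqxx.
  by rewrite andbT leqNgt ltij.
apply/andP; split; last first.
  apply/negP => /splitPr T1; case: T1 irr_w => a b; apply.
  by exists (a, [:: T 1%g], 1, b); split=> //; apply: rule_one.
have adj a x y b : w = a ++ [:: x, y & b] -> letter_le x y.
  move=> ew; apply: contra_notT irr_w.
  case: x y ew => [i|g] [j|h] //= ew; rewrite -?ltnNge => ltij.
  - by eexists (a, [:: X i; X j], _, b); split => //=; apply: rule_comm.
  - by eexists (a, [:: T g; X j], _, b); split => //=; apply: rule_act.
  - by eexists (a, [:: T g; T h], _, b); split => //=; apply: rule_mul.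
elim: w {irr_w} adj => //= x [|y w] //= IH adj.
rewrite (adj [::] x y w) //=; apply: IH => a x' y' b e.
by apply: (adj (x :: a) x' y' b); rewrite e.
Qed.

End Rule.

End NormalWords.

(** * Morphisms out of free algebras *)

Section WordIdeal.
Variables (K : fieldType) (A : algType K) (X : choiceType) (word : seq X -> A).
Hypothesis word_nil : word [::] = 1.
Hypothesis word_cat : forall a b, word (a ++ b) = word a * word b.
Hypothesis word_total : forall p, word_span word (fun=> True) p.

Lemma linear_word_eq (M : lmodType K) (F G : A -> M) :
  linear F -> linear G -> (forall w, F (word w) = G (word w)) -> F =1 G.
Proof. by move=> linF linG eqFG p; apply: linear_word_span_eq (word_total p) _. Qed.

(** Lets a map that is merely linear, such as the normal form map, pass to the quotient. The
    induction carries arbitrary factors [p] and [q] because [ideal_gen_mul] enlarges the context; at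
    a relation, linearity reduces them to words. *)
Lemma ideal_gen_linear0 (R : A -> Prop) (M : lmodType K) (F : {linear A -> M}) :
  (forall a b r, R r -> F (word a * r * word b) = 0) ->
  forall x, ideal_gen R x -> F x = 0.
Proof.
move=> F0 x Rx.
have lin0 : linear ((fun=> 0) : A -> M) by move=> c p q /=; rewrite scaler0 addr0.
suff: forall p q, F (p * x * q) = 0 by move=> /(_ 1 1); rewrite mul1r mulr1.
elim: Rx => {x} [r Rr|||] p.
- move=> q; apply: (@linear_word_eq M (fun z => F (z * r * q)) (fun=> 0) _ lin0).
    by move=> c y z; rewrite !mulrDl linearD -!scalerAl linearZ.
  move=> w; apply: (@linear_word_eq M (fun z => F (word w * r * z)) (fun=> 0) _ lin0).
    by move=> c y z; rewrite mulrDr linearD -scalerAr linearZ.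
  by move=> w'; apply: F0.
- by move=> q; rewrite mulr0 mul0r linear0.
- by move=> y _ IHx _ IHy p' q; rewrite mulrDr mulrDl linearD IHx IHy addr0.
- move=> x b _ IH p' q; have := IH (p' * p) (b * q).
  by rewrite !mulrA.
Qed.

Lemma linear_multiplicative (B : algType K) (F : {linear A -> B}) :
  (forall a b, F (word (a ++ b)) = F (word a) * F (word b)) ->
  {morph F : p q / p * q}.
Proof.
move=> FM p q.
apply: (@linear_word_eq B (fun z => F (z * q)) (fun z => F z * F q)).
- by move=> c y z; rewrite mulrDl linearD -scalerAl linearZ.
- by move=> c y z; rewrite linearD linearZ /= mulrDl scalerAl.
move=> w.
apply: (@linear_word_eq B (fun z => F (word w * z))
  (fun z => F (word w) * F z)).
- by move=> c y z; rewrite mulrDr linearD -scalerAr linearZ.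
- by move=> c y z; rewrite linearD linearZ /= mulrDr scalerAr.
by move=> w'; rewrite -word_cat FM.
Qed.

End WordIdeal.

Lemma ideal_gen_morph (K : fieldType) (A B : algType K) (R : A -> Prop)
    (R' : B -> Prop) (F : {linear A -> B}) :
  {morph F : p q / p * q} -> (forall r, R r -> ideal_gen R' (F r)) ->
  forall x, ideal_gen R x -> ideal_gen R' (F x).
Proof.
move=> FM FR x; elim=> {x} [r /FR //||x z _ IHx _ IHz|a x b _ IH].
- by rewrite linear0; apply: ideal_gen_0.
- by rewrite linearD; apply: ideal_gen_add.
- by rewrite !FM; apply: ideal_gen_mul.
Qed.

Lemma freealg_word_span (K : fieldType) (X : choiceType) (p : freealg K X) :
  word_span word (fun=> True) p.
Proof.
exists [seq (mcoeff k p, k : seq X) | k <- msupp p] => //.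
by rewrite big_map {1}[p]freealgE.
Qed.

Section FreeAlgebraMorphism.
Variables (K : fieldType) (X Y : choiceType) (y : X -> freealg K Y).

Lemma word_prod (w : seq X) : word w = \prod_(x <- w) gen K x.
Proof.
elim: w => [|x w IH]; first by rewrite word_nil big_nil.
by rewrite big_cons -IH -word1 -word_cat.
Qed.

Definition alg_lift : freealg K X -> freealg K Y :=
  word_lift (fun w => \prod_(x <- w) y x).
HB.instance Definition _ := GRing.Linear.on alg_lift.

Lemma alg_lift_word w : alg_lift (word w) = \prod_(x <- w) y x.
Proof. exact: word_lift_word. Qed.

Lemma alg_lift_gen x : alg_lift (gen K x) = y x.
Proof. by rewrite -word1 alg_lift_word big_seq1. Qed.

Lemma alg_lift1 : alg_lift 1 = 1.
Proof. by rewrite -word_nil alg_lift_word big_nil. Qed.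

Lemma alg_liftM p q : alg_lift (p * q) = alg_lift p * alg_lift q.
Proof.
apply: (linear_multiplicative (@word_cat K X) (@freealg_word_span K X)) => a b.
by rewrite /= !alg_lift_word big_cat.
Qed.

Variables (R : freealg K X -> Prop) (R' : freealg K Y -> Prop).
Hypothesis lift_rel : forall r, R r -> ideal_gen R' (alg_lift r).

Lemma alg_lift_ideal x : ideal_gen R x -> ideal_gen R' (alg_lift x).
Proof. by apply: ideal_gen_morph => //; apply: alg_liftM. Qed.

Definition quot_lift (x : quotalg R) : quotalg R' :=
  quotmap R' (alg_lift (repr x)).

Lemma quot_liftE p : quot_lift (quotmap R p) = quotmap R' (alg_lift p).
Proof. by apply/quotmapP; rewrite -linearB; apply/alg_lift_ideal/ideal_repr. Qed.

Lemma quot_lift_zmod : zmod_morphism quot_lift.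
Proof.
move=> p q; rewrite -[p]quotmapK -[q]quotmapK.
by rewrite -raddfB !quot_liftE linearB raddfB.
Qed.

Lemma quot_lift_monoid : monoid_morphism quot_lift.
Proof.
split=> [|p q]; first by rewrite -[1]/(quotmap R 1) quot_liftE alg_lift1.
rewrite -[p]quotmapK -[q]quotmapK.
by rewrite -rmorphM !quot_liftE alg_liftM rmorphM.
Qed.

Lemma quot_lift_scalable : scalable quot_lift.
Proof.
move=> a p; rewrite -[p]quotmapK -linearZ !quot_liftE.
by rewrite [alg_lift _]linearZ [LHS]linearZ.
Qed.

End FreeAlgebraMorphism.

Lemma alg_lift_comp (K : fieldType) (X Y Z : choiceType)
    (y : Y -> freealg K Z) (x : X -> freealg K Y) p :
  alg_lift y (alg_lift x p) = alg_lift (fun i => alg_lift y (x i)) p.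
Proof.
apply: (linear_word_eq (@freealg_word_span K X) (F := alg_lift y \o alg_lift x)).
- by move=> c q r /=; rewrite !linearP.
- exact: linearP.
move=> w; rewrite /= !alg_lift_word.
elim: w => [|i w IH]; first by rewrite !big_nil alg_lift1.
by rewrite !big_cons alg_liftM IH.
Qed.

Lemma alg_lift_id (K : fieldType) (X : choiceType) (p : freealg K X) :
  alg_lift (gen K) p = p.
Proof.
apply: (linear_word_eq (@freealg_word_span K X) (G := id)) => //.
  exact: linearP.
by move=> w; rewrite alg_lift_word word_prod.
Qed.

Lemma eq_alg_lift (K : fieldType) (X Y : choiceType) (y z : X -> freealg K Y) :
  y =1 z -> alg_lift y =1 alg_lift z.
Proof.
move=> yz; apply: (linear_word_eq (@freealg_word_span K X)).
- exact: linearP.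
- exact: linearP.
by move=> w; rewrite !alg_lift_word; apply: eq_bigr.
Qed.

(** * Automorphisms of the quantum polynomial algebra *)

(** The quadratic half of [overlap_act_comm], computed in S_Q(V): the coefficients are the same, so
    their vanishing means that h preserves the relations. *)
Lemma linear_straighten (K : fieldType) (n : nat) (gT : finGroupType)
    (E : gT -> 'I_n -> 'I_n -> K) (Q : 'I_n -> 'I_n -> K) (A : algType K)
    (M : lmodType K) (L : {linear A -> M}) (x : 'I_n -> A) h (i j : 'I_n) :
  (forall k l : 'I_n, (k < l)%N -> L (x l * x k) = Q k l *: L (x k * x l)) ->
  let y i := \sum_k E h k i *: x k in
  L (y j * y i - Q i j *: (y i * y j)) =
  \sum_(k < n) \sum_(l < n | (k <= l)%N)
    straight_coef Q (minor E Q h i j) k l *: L (x k * x l).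
Proof.
move=> hx y; pose P l k := L (x l * x k).
have actM a b : L (y a * y b) = \sum_k \sum_l (E h l a * E h k b) *: P l k.
  rewrite exchange_big mulr_suml linear_sum; apply: eq_bigr => l _.
  rewrite mulr_sumr linear_sum; apply: eq_bigr => k _ /=.
  by rewrite -scalerAl -scalerAr scalerA linearZ.
rewrite linearB linearZ /= !actM [Q i j *: _]scaler_sumr -sumrB.
transitivity (\sum_k \sum_l minor E Q h i j k l *: P l k).
  apply: eq_bigr => k _; rewrite scaler_sumr -sumrB; apply: eq_bigr => l _.
  by rewrite scalerA -scalerBl /minor [E h l j * _]mulrC.
rewrite (sum_straighten _ (P := P) (Q := Q) (e := fun _ _ => 0)) => [|k l ltkl].
  rewrite [X in _ + X]big1 ?addr0 // => k _.
  by apply: big1 => l _; rewrite scaler0.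
by rewrite addr0 /P hx.
Qed.

Lemma linear_dual_pair (K : fieldType) (n : nat) (A : algType K)
    (L : {linear A -> K^o}) (x : 'I_n -> 'I_n -> A) (c : 'I_n -> 'I_n -> K)
    (k l : 'I_n) :
  (k <= l)%N ->
  (forall k' l' : 'I_n, (k' <= l')%N ->
     L (x k' l') = ((k' == k) && (l' == l))%:R) ->
  L (\sum_(k' < n) \sum_(l' < n | (k' <= l')%N) c k' l' *: x k' l') = c k l.
Proof.
move=> lekl Lx; rewrite linear_sum (bigD1 k) //= linear_sum (bigD1 l) //=.
rewrite linearZ /= Lx // !eqxx [_ *: _]mulr1 !big1 ?addr0 //.
  move=> k' /negPf nek; rewrite linear_sum big1 // => l' lekl'.
  by rewrite linearZ /= Lx // nek scaler0.
move=> l' /andP[lekl' /negPf nel].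
by rewrite linearZ /= Lx // nel andbF scaler0.
Qed.

Lemma linear_qcomm (K : fieldType) (A B : algType K) (F : {linear A -> B})
    (c : K) (x y : A) : {morph F : p q / p * q} ->
  F (x * y - c *: (y * x)) = F x * F y - c *: (F y * F x).
Proof. by move=> FM; rewrite linearB linearZ /= !FM. Qed.

Lemma quot_morph_qcomm (K : fieldType) (A : algType K) (R : A -> Prop)
    (f : {rmorphism quotalg R -> quotalg R}) (c : K) (x y x' y' : A) :
  scalable f ->
  f (quotmap R x) = quotmap R x' -> f (quotmap R y) = quotmap R y' ->
  ideal_gen R (x * y - c *: (y * x)) ->
  quotmap R (x' * y' - c *: (y' * x')) = 0.
Proof.
move=> fZ fx fy /quotmapP; rewrite linearZ !rmorphM /= => /(congr1 f).
rewrite fZ !rmorphM fx fy => e.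
by rewrite raddfB /= linearZ !rmorphM /= e subrr.
Qed.

Section QuantumPolynomials.
Variables (K : fieldType) (V : vectType K) (n : nat) (v : n.-tuple V).
Variables (gT : finGroupType) (rho : gT -> 'End(V)) (Q : 'M[K]_n).
Hypothesis v_basis : basis_of fullv v.
Hypothesis rho_rep : faithful_rep rho.
Implicit Types (i j k l : 'I_n) (g h : gT).

Definition rep_entry g k i : K := entry v (rho g) k i.

Lemma coord_tuple i j : coord v i v`_j = (i == j)%:R.
Proof. by rewrite coord_free ?(basis_free v_basis) // eq_sym. Qed.

Lemma vector_coordE u : u = \sum_i coord v i u *: v`_i.
Proof. exact: (coord_basis v_basis (memvf u)). Qed.

Lemma rep_entry1 k i : rep_entry 1%g k i = (k == i)%:R.
Proof.
by case: rho_rep => rho1 _ _; rewrite /rep_entry /entry rho1 id_lfunE coord_tuple.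
Qed.

Lemma coord_rho g u k :
  coord v k (rho g u) = \sum_i coord v i u * rep_entry g k i.
Proof.
rewrite {1}[u]vector_coordE !linear_sum; apply: eq_bigr => i _.
by rewrite !linearZ.
Qed.

Lemma rep_entryM g h l i :
  rep_entry (g * h)%g l i = \sum_k rep_entry g l k * rep_entry h k i.
Proof.
case: rho_rep => _ rhoM _; rewrite {1}/rep_entry /entry rhoM comp_lfunE coord_rho.
by apply: eq_bigr => k _; rewrite mulrC.
Qed.

Definition act_gen g i : freealg K 'I_n := \sum_k rep_entry g k i *: gen K k.

Lemma qpoly_comm i j : (i < j)%N ->
  quotmap (qpoly_rel Q) (gen K j * gen K i) =
  Q i j *: quotmap (qpoly_rel Q) (gen K i * gen K j).
Proof.
move=> ltij; rewrite -linearZ; apply/quotmapP.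
exact/ideal_gen_rel/qpoly_rel_comm.
Qed.

Lemma qpoly_act_rel h i j :
  quotmap (qpoly_rel Q) (act_gen h j * act_gen h i -
                         Q i j *: (act_gen h i * act_gen h j)) =
  \sum_(k < n) \sum_(l < n | (k <= l)%N)
    straight_coef Q (minor rep_entry Q h i j) k l *:
      quotmap (qpoly_rel Q) (gen K k * gen K l).
Proof.
pose L : {linear freealg K 'I_n -> quotalg (qpoly_rel Q)} := quotmap (qpoly_rel Q).
have comm k l : (k < l)%N ->
    L (gen K l * gen K k) = Q k l *: L (gen K k * gen K l) by apply: qpoly_comm.
exact: (linear_straighten rep_entry h i j comm).
Qed.

(** The coefficient of x_k x_l after straightening, as a functional on the free algebra; x_l x_k
    contributes q_kl. It separates the quadratic monomials of the quotient. *)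
Definition qpoly_coord k l : {linear freealg K 'I_n -> K^o} :=
  @word_lift K 'I_n K^o (fun w => if w == [:: k; l] then 1
                      else if w == [:: l; k] then Q k l else 0).

Lemma qpoly_coord_ideal k l x :
  (k <= l)%N -> ideal_gen (qpoly_rel Q) x -> qpoly_coord k l x = 0.
Proof.
move=> lekl; apply: (ideal_gen_linear0 (@freealg_word_span K 'I_n)) => a b r.
case=> i j ltij; rewrite mulrBr mulrBl linearB.
rewrite -scalerAr -scalerAl linearZ /= -!word1 -!word_cat !word_lift_word.
(* In a nonempty context the words of the relation have length at least three, where the functional
   is zero. *)
have [ab0|ab_n0] := altP (a ++ b =P [::]); last first.
  have sz c d (p q : 'I_n) : ((a ++ [:: p] ++ [:: q]) ++ b == [:: c; d]) = false.
    apply: contraNF ab_n0 => /eqP/(congr1 size); rewrite !size_cat /= => e.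
    by rewrite -size_eq0 size_cat; apply/eqP; move: (size a) (size b) e => sa sb; lia.
  by rewrite !sz scaler0 subrr.
have [-> ->] : a = [::] /\ b = [::] by move: ab0; case: (a) => [|? ?] /=; [move=> ->|].
rewrite /= !eqseq_cons !andbT.
have -> : (j == k) && (i == l) = false.
  by apply/negP => /andP[/eqP jk /eqP il]; move: ltij lekl; rewrite jk il; lia.
have -> : (i == l) && (j == k) = false.
  by apply/negP => /andP[/eqP il /eqP jk]; move: ltij lekl; rewrite jk il; lia.
rewrite [(j == l) && _]andbC; case: andP => [[/eqP-> /eqP->]|_].
  by rewrite [_ *: _]mulr1 subrr.
by rewrite scaler0 subrr.
Qed.

Lemma qpoly_coord_gen k l k' l' : (k <= l)%N -> (k' <= l')%N ->
  qpoly_coord k l (gen K k' * gen K l') = ((k' == k) && (l' == l))%:R.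
Proof.
move=> lekl lekl'; rewrite -!word1 -word_cat /= word_lift_word /= !eqseq_cons !andbT.
case: ifP => // /negbT neq; case: ifP => // /andP[/eqP ek /eqP el].
case/negP: neq; rewrite ek el in lekl' *.
have /val_inj -> : val l = val k by apply/eqP; rewrite eqn_leq lekl'.
by rewrite eqxx.
Qed.


Lemma qpoly_monomials_free (c : 'I_n -> 'I_n -> K) :
  \sum_(k < n) \sum_(l < n | (k <= l)%N)
    c k l *: quotmap (qpoly_rel Q) (gen K k * gen K l) = 0 ->
  forall k l, (k <= l)%N -> c k l = 0.
Proof.
move=> sum0 k l lekl.
pose p := \sum_(k < n) \sum_(l < n | (k <= l)%N) c k l *: (gen K k * gen K l).
have p0 : qpoly_coord k l p = 0.
  apply: qpoly_coord_ideal => //; rewrite -[p]subr0; apply/quotmapP.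
  pose L : {linear freealg K 'I_n -> quotalg (qpoly_rel Q)} := quotmap (qpoly_rel Q).
  rewrite raddf0 -[RHS]sum0 -[LHS]/(L p) linear_sum; apply: eq_bigr => k' _.
  by rewrite linear_sum; apply: eq_bigr => l' _; rewrite linearZ.
rewrite -[RHS]p0; symmetry.
by apply: linear_dual_pair => // k' l' lekl'; apply: qpoly_coord_gen.
Qed.

Lemma qpoly_vect_tuple i : qpoly_vect v Q v`_i = quotmap (qpoly_rel Q) (gen K i).
Proof.
congr quotmap; rewrite (bigD1 i) //= coord_tuple eqxx scale1r big1 ?addr0 //.
by move=> k /negPf ki; rewrite coord_tuple ki scale0r.
Qed.

Lemma act_gen_comp g h i :
  alg_lift (act_gen g) (act_gen h i) = act_gen (g * h)%g i.
Proof.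
rewrite linear_sum; under eq_bigr => k _.
  rewrite linearZ /= alg_lift_gen scaler_sumr; over.
rewrite exchange_big; apply: eq_bigr => l _.
rewrite rep_entryM scaler_suml; apply: eq_bigr => k _.
by rewrite scalerA mulrC.
Qed.

Lemma act_gen1 i : act_gen 1%g i = gen K i.
Proof.
rewrite /act_gen (bigD1 i) //= rep_entry1 eqxx scale1r big1 ?addr0 // => k /negPf ki.
by rewrite rep_entry1 ki scale0r.
Qed.

(** An algebra map extending h sends each relation to one between the independent x_k x_l, which
    kills the coefficients. Conversely the coefficients give well-defined lifts for all group
    elements, and the lift of h^-1 inverts that of h. *)
Lemma acts_on_qpolyP :
  acts_on_qpoly v rho Q <->
  (forall h i j, (i < j)%N -> forall k l, (k <= l)%N ->
     straight_coef Q (minor rep_entry Q h i j) k l = 0).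
Proof.
split=> [acts h i j ltij|coef0 h].
  have [f [f_scal _ f_vect]] := acts h.
  have f_gen a : f (quotmap (qpoly_rel Q) (gen K a)) =
      quotmap (qpoly_rel Q) (act_gen h a).
    by rewrite -qpoly_vect_tuple f_vect.
  apply: qpoly_monomials_free; rewrite -qpoly_act_rel.
  apply: (quot_morph_qcomm f_scal (f_gen j) (f_gen i)).
  exact/ideal_gen_rel/qpoly_rel_comm.
have lift_rel g r : qpoly_rel Q r ->
    ideal_gen (qpoly_rel Q) (alg_lift (act_gen g) r).
  case=> i j ltij; rewrite -[alg_lift _ _]subr0; apply/quotmapP.
  rewrite (linear_qcomm _ _ _ (alg_liftM (act_gen g))) /= !alg_lift_gen.
  rewrite qpoly_act_rel raddf0.
  by apply: big1 => k _; apply: big1 => l lekl; rewrite coef0 // scale0r.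
pose f g := @quot_lift K _ _ (act_gen g) (qpoly_rel Q) (qpoly_rel Q).
have fK g : cancel (f g^-1%g) (f g).
  have fE g' p : f g' (quotmap (qpoly_rel Q) p) =
        quotmap (qpoly_rel Q) (alg_lift (act_gen g') p).
    exact: quot_liftE (lift_rel g') p.
  move=> x; rewrite -[x]quotmapK; move: (repr x) => p; rewrite (fE g^-1%g p) (fE g).
  rewrite alg_lift_comp (eq_alg_lift (z := gen K)) ?alg_lift_id // => i.
  by rewrite act_gen_comp mulgV act_gen1.
pose fh := HB.pack_for {rmorphism Defs.qpoly Q -> Defs.qpoly Q} (f h)
  (GRing.isZmodMorphism.Build (Defs.qpoly Q) (Defs.qpoly Q) (f h)
     (quot_lift_zmod (lift_rel h)))
  (GRing.isMonoidMorphism.Build (Defs.qpoly Q) (Defs.qpoly Q) (f h)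
     (quot_lift_monoid (lift_rel h))).
exists fh; split.
- exact: quot_lift_scalable (lift_rel h).
- exists (f h^-1%g); last exact: fK.
  by have := fK h^-1%g; rewrite invgK.
move=> u; rewrite /fh /= /f quot_liftE; last exact: lift_rel.
congr quotmap; rewrite linear_sum; under eq_bigr => i _.
  rewrite linearZ /= alg_lift_gen scaler_sumr; over.
rewrite exchange_big; apply: eq_bigr => k _.
rewrite coord_rho scaler_suml; apply: eq_bigr => i _.
by rewrite scalerA.
Qed.

End QuantumPolynomials.

(** * Bases and necessary conditions *)

Section IdealClosure.
Variables (K : fieldType) (A : algType K) (R : A -> Prop).

Lemma ideal_genZ c x : ideal_gen R x -> ideal_gen R (c *: x).
Proof. by move=> /(ideal_gen_mul (c%:A) 1); rewrite mulr1 mulr_algl. Qed.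

Lemma ideal_gen_sum (I : finType) (F : I -> A) :
  (forall i, ideal_gen R (F i)) -> ideal_gen R (\sum_i F i).
Proof.
by move=> RF; apply: big_ind => //; [apply: ideal_gen_0|apply: ideal_gen_add].
Qed.

Lemma ideal_gen_sub (R' : A -> Prop) x :
  (forall r, R r -> ideal_gen R' r) -> ideal_gen R x -> ideal_gen R' x.
Proof.
move=> sub; elim=> {x} [r /sub //||x y _ Rx _ Ry|a x b _ Rx].
- exact: ideal_gen_0.
- exact: ideal_gen_add.
- exact: ideal_gen_mul.
Qed.

Lemma quotmap_respects (X : choiceType) (word : seq X -> A)
    (rule : seq X -> A -> Prop) :
  (forall a b, word (a ++ b) = word a * word b) ->
  (forall l r, rule l r -> ideal_gen R (word l - r)) ->
  respects word rule (quotmap R) (fun=> True).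
Proof.
move=> word_cat ruleR a l r b /ruleR/(ideal_gen_mul (word a) (word b)) h _.
by apply/quotmapP; rewrite !word_cat mulrA -mulrBl -mulrBr.
Qed.

End IdealClosure.

Section PBWBasis.
Variables (K : fieldType) (n : nat) (gT : finGroupType).
Variables (E : gT -> 'I_n -> 'I_n -> K) (Q : 'I_n -> 'I_n -> K).
Variable kappa : 'I_n -> 'I_n -> gT -> K.
Variables (A : algType K) (word : seq ('I_n + gT) -> A).
Hypothesis word_nil : word [::] = 1.
Hypothesis word_cat : forall a b, word (a ++ b) = word a * word b.
Hypothesis word_total : forall p, word_span word (fun=> True) p.
Local Notation letter := ('I_n + gT)%type.
Local Notation X i := (inl i : letter).
Local Notation T g := (inr g : letter).
Local Notation pbw_rule := (pbw_rule E Q kappa word).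
Local Notation index := ({ffun 'I_n -> nat} * gT)%type.

(** Unlike [normal_word] it keeps a final t_1, as [qdh_monomial] does. *)
Definition monomial_word (s : seq 'I_n) (g : gT) : seq letter :=
  map inl s ++ [:: T g].

Section Spanning.
Variables (M : lmodType K) (L : {linear A -> M}).
Hypothesis L_rule : respects word pbw_rule L (fun=> True).

Lemma monomial_normal_word m g :
  L (word (monomial_word (sorted_seq m) g)) = L (word (normal_word m g)).
Proof.
rewrite /monomial_word /normal_word; case: eqVneq => // ->.
by rewrite (respects_one word_cat L_rule).
Qed.

Lemma word_span_image P p : word_span word P p ->
  (forall w, P w -> exists S : seq (K * index),
     L (word w) = \sum_(t <- S) t.1 *: L (word (normal_word t.2.1 t.2.2))) ->
  exists S : seq (K * index),
    L p = \sum_(t <- S) t.1 *: L (word (normal_word t.2.1 t.2.2)).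
Proof.
case=> s sP -> hP; rewrite linear_sum /=.
elim: s sP => [|[c w] s IH] sP; first by exists [::]; rewrite !big_nil.
have [|S1 e1] := IH; first by move=> t ts; apply: sP; rewrite inE ts orbT.
have [|S2 e2] := hP w; first by apply: (sP (c, w)); rewrite inE eqxx.
exists ([seq (c * t.1, t.2) | t <- S2] ++ S1).
rewrite big_cons big_cat big_map e1 linearZ /= e2 scaler_sumr; congr (_ + _).
by apply: eq_bigr => t _; rewrite scalerA.
Qed.

(** Termination alone gives spanning: a reducible word is replaced by words of smaller value at 0,
    and no overlap has to resolve. *)
Lemma normal_words_span p : exists S : seq (K * index),
  L p = \sum_(t <- S) t.1 *: L (word (normal_word t.2.1 t.2.2)).
Proof.
apply: word_span_image (word_total p) _ => w _.
have [d] := ubnP (eval_word w 0); elim: d w => // d IH w; rewrite ltnS => le_wd.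
have [irr|red] := boolP (irreducible_word w).
  have [m [g ->]] := irreducible_wordE irr.
  by exists [:: (1, (m, g))]; rewrite big_seq1 scale1r.
have : reducible pbw_rule w.
  apply: contrapT => nred; move/negP: red; apply.
  by move: nred => /irreducible_wordP.
case=> -[[[a l] r] b] /= [rl ew].
have sp : word_span word (@word_lt n gT ^~ w) (word a * r * word b).
  apply: (word_span_ctx word_cat _ (pbw_rule_lt word_nil rl)) => u.
  by rewrite ew; apply: word_lt_ctx.
rewrite {1}ew (L_rule rl) //; apply: word_span_image sp _ => u lt_uw; apply: IH.
exact: leq_trans (lt_uw 0%N) le_wd.
Qed.

End Spanning.

Lemma normal_words_free (lift : (seq letter -> A) -> {linear A -> A})
    (N : {linear A -> A}) (s : seq index) (c : index -> K) :
  (forall f w, lift f (word w) = f w) ->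
  respects word pbw_rule N (fun=> True) ->
  (forall w, ~ reducible pbw_rule w -> N (word w) = word w) -> uniq s ->
  N (\sum_(t <- s) c t *: word (monomial_word (sorted_seq t.1) t.2)) = 0 ->
  {in s, forall t, c t = 0}.
Proof.
move=> lift_word N_rule N_irr uniq_s + t ts.
(* The indicator of one normal word extends to a linear map into [A], where the coefficient appears
   as a multiple of 1, which is nonzero. *)
rewrite linear_sum /= => /(congr1 (lift (fun w =>
  if w == normal_word t.1 t.2 then 1 else 0))).
rewrite linear0 linear_sum (bigD1_seq t) //= big1 ?addr0 => [|t' t't].
  rewrite linearZ /= monomial_normal_word // N_irr; last first.
    exact/irreducible_wordP/irreducible_normal_word.
  rewrite linearZ /= lift_word eqxx => /eqP.
  by rewrite scaler_eq0 oner_eq0 orbF => /eqP.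
rewrite linearZ /= monomial_normal_word // N_irr; last first.
  exact/irreducible_wordP/irreducible_normal_word.
rewrite linearZ /= lift_word; case: eqP => [/normal_word_inj|]; last first.
  by rewrite scaler0.
by case: t t' t't {ts} => [m g] [m' g'] /= /eqP ne e; case: ne.
Qed.

End PBWBasis.

Lemma spanning_family (K : fieldType) (M : lmodType K) (I : choiceType)
    (b : I -> M) (S : seq (K * I)) :
  exists (s : seq I) (c : I -> K),
    \sum_(t <- S) t.1 *: b t.2 = \sum_(i <- s) c i *: b i.
Proof.
exists (undup (map snd S)), (fun i => \sum_(t <- S | t.2 == i) t.1).
under [RHS]eq_bigr do rewrite scaler_suml.
rewrite (exchange_big_dep xpredT) //=; apply: eq_big_seq => t tS.
rewrite big_mkcond (bigD1_seq t.2) ?undup_uniq ?mem_undup ?map_f //= eqxx.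
by rewrite big1 ?addr0 // => i /negPf; rewrite eq_sym => ->.
Qed.

(** * Conditions forced by the independence of the monomials *)

Section Necessity.
Variables (K : fieldType) (n : nat) (gT : finGroupType).
Variables (E : gT -> 'I_n -> 'I_n -> K) (Q : 'I_n -> 'I_n -> K).
Variable kappa : 'I_n -> 'I_n -> gT -> K.
Variables (A : algType K) (word : seq ('I_n + gT) -> A).
Hypothesis word_nil : word [::] = 1.
Hypothesis word_cat : forall a b, word (a ++ b) = word a * word b.
Local Notation letter := ('I_n + gT)%type.
Local Notation X i := (inl i : letter).
Local Notation T g := (inr g : letter).
Local Notation pbw_rule := (pbw_rule E Q kappa word).

Variables (M : lmodType K) (L : {linear A -> M}).
Hypothesis L_rule : respects word pbw_rule L (fun=> True).
(** Independence in the shape that the overlaps deliver: sums over finite types, with exponents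
    given as sorted lists, so that x_k x_l is [[:: k; l]]. *)
Hypothesis L_free : forall (J : finType) (P : pred J) (e : J -> seq 'I_n * gT)
    (c : J -> K),
  (forall j, P j -> sorted (@ord_le n) (e j).1) -> {in P &, injective e} ->
  \sum_(j | P j) c j *: L (word (monomial_word (e j).1 (e j).2)) = 0 ->
  forall j, P j -> c j = 0.

Lemma free_quadratic (a : 'I_n -> 'I_n -> K) (c : gT -> K) h :
  \sum_(k < n) \sum_(l < n | (k <= l)%N) a k l *: L (word [:: X k; X l; T h]) +
  \sum_g c g *: L (word [:: T (g * h)%g]) = 0 ->
  (forall k l : 'I_n, (k <= l)%N -> a k l = 0) /\ (forall g, c g = 0).
Proof.
move=> sum0.
(* Quadratic and group terms form a single family: they differ in length, and g -> gh is
   injective. *)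
pose J := ('I_n * 'I_n + gT)%type.
pose P (j : J) := if j is inl kl then (kl.1 <= kl.2)%N else true.
pose e (j : J) := match j with inl kl => ([:: kl.1; kl.2], h)
                             | inr g => ([::], (g * h)%g) end.
pose d (j : J) := match j with inl kl => a kl.1 kl.2 | inr g => c g end.
have d0 : forall j, P j -> d j = 0.
  apply: (L_free (e := e)).
  - by case=> [[k l]|g] //=; rewrite /ord_le andbT.
  - case=> [[k l]|g] [[k' l']|g'] _ _ //= [].
      by move=> -> ->.
    by move=> /mulIg ->.
  - rewrite big_sumType /= -[RHS]sum0; congr (_ + _).
    by rewrite pair_big_dep.
split=> [k l lekl|g]; first exact: (d0 (inl (k, l))).
exact: (d0 (inr g)).
Qed.

Lemma free_linear (c : gT -> 'I_n -> K) :
  \sum_g \sum_l c g l *: L (word [:: X l; T g]) = 0 -> forall g l, c g l = 0.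
Proof.
move=> sum0 g l.
pose e (gl : gT * 'I_n) := ([:: gl.2], gl.1).
pose d (gl : gT * 'I_n) := c gl.1 gl.2.
suff d0 : forall gl, xpredT gl -> d gl = 0 by exact: (d0 (g, l)).
apply: (L_free (e := e)) => //.
  by move=> [g1 l1] [g2 l2] _ _ /= [-> ->].
by rewrite -[RHS]sum0 pair_big.
Qed.

Lemma pbw_straight_kappa h (i j : 'I_n) : (i < j)%N ->
  (forall k l : 'I_n, (k <= l)%N -> straight_coef Q (minor E Q h i j) k l = 0) /\
  (forall g, kappa i j (h^-1 * g * h)%g =
     \sum_(k < n) \sum_(l < n | (k < l)%N) minor E Q h i j k l * kappa k l g).
Proof.
move=> ltij.
have [//|coef0 kappa0] := free_quadratic
    (a := straight_coef Q (minor E Q h i j)) (h := h)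
    (c := fun g => (\sum_(k < n) \sum_(l < n | (k < l)%N)
        minor E Q h i j k l * kappa k l g) - kappa i j (h^-1 * g * h)%g).
  rewrite -(overlap_act_comm word_cat ltij); last by move=> ? ? ? ? /L_rule ->.
  have := L_rule (a := [::]) (b := [:: X i]) (rule_act _ _ _ _ h j) I.
  have := L_rule (a := [:: T h]) (b := [::]) (rule_comm _ _ _ _ ltij) I.
  by rewrite /= word_nil mul1r mulr1 => -> ->; rewrite subrr.
split=> // g; apply/eqP; rewrite eq_sym -subr_eq0; apply/eqP; exact: kappa0.
Qed.

Lemma pbw_jacobi g (i j k l : 'I_n) : (i < j)%N -> (j < k)%N ->
  jacobi_coef E Q kappa g i j k l = 0.
Proof.
move=> ltij ltjk; move: g l; apply: free_linear.
rewrite -(overlap_comm_comm word_cat ltij ltjk); last by move=> ? ? ? ? /L_rule ->.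
have := L_rule (a := [::]) (b := [:: X i]) (rule_comm _ _ _ _ ltjk) I.
have := L_rule (a := [:: X k]) (b := [::]) (rule_comm _ _ _ _ ltij) I.
by rewrite /= word_nil mul1r mulr1 => -> ->; rewrite subrr.
Qed.

Hypothesis L_comm : forall i j, L (word [:: X j; X i]) =
  L (Q i j *: word [:: X i; X j] + \sum_g kappa i j g *: word [:: T g]).

Lemma pbw_relationE i j : L (word [:: X j; X i]) =
  Q i j *: L (word [:: X i; X j]) + \sum_g kappa i j g *: L (word [:: T g]).
Proof.
rewrite L_comm linearD linearZ linear_sum; congr (_ + _).
by apply: eq_bigr => g _; rewrite linearZ.
Qed.

Lemma free_monomial2 (i j : 'I_n) q (c : gT -> K) : (i <= j)%N ->
  q *: L (word [:: X i; X j]) + \sum_g c g *: L (word [:: T g]) = 0 ->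
  q = 0 /\ forall g, c g = 0.
Proof.
move=> leij sum0; pose a (k l : 'I_n) := q * ((k == i) && (l == j))%:R.
have [|a0 c0] := @free_quadratic a c 1%g.
  rewrite (bigD1 i) //= (bigD1 j) //= /a !eqxx mulr1.
  rewrite [Y in _ + Y + _]big1 => [|k /negPf ->]; last first.
    by apply: big1 => l _; rewrite mulr0 scale0r.
  rewrite [Y in _ + Y + _ + _]big1 => [|l /andP[_ /negPf ->]]; last first.
    by rewrite andbF mulr0 scale0r.
  (* With h = 1 the monomials of [free_quadratic] end in t_1, which the rule t_1 -> 1 removes. *)
  rewrite !addr0 (respects_one word_cat L_rule (a := [:: _; _]) (b := [::])) //.
  by rewrite -[RHS]sum0; congr (_ + _); apply: eq_bigr => g _; rewrite mulg1.
by split=> //; rewrite -(a0 i j leij) /a !eqxx mulr1.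
Qed.

Lemma pbw_relation_diag i : Q i i = 1 /\ forall g, kappa i i g = 0.
Proof.
have [|Q1 kappa0] := @free_monomial2 i i (Q i i - 1) (kappa i i) (leqnn i).
  by rewrite scalerBl scale1r addrAC -pbw_relationE subrr.
by split=> //; apply/eqP; rewrite -subr_eq0 Q1.
Qed.

(** Rewriting x_i x_j by the relation for (j, i) and then x_j x_i by that for (i, j) returns q_ij
    q_ji x_i x_j plus group terms; comparison with x_i x_j gives both identities. *)
Lemma pbw_relation_twice (i j : 'I_n) : (i <= j)%N ->
  Q i j * Q j i = 1 /\ forall g, kappa j i g = - Q j i * kappa i j g.
Proof.
move=> leij.
pose c g := kappa j i g + Q j i * kappa i j g.
have [|q0 c0] := @free_monomial2 i j (Q i j * Q j i - 1) c leij.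
  have e := pbw_relationE j i; rewrite (pbw_relationE i j) scalerDr scalerA in e.
  have -> : \sum_g c g *: L (word [:: T g]) =
      Q j i *: (\sum_g kappa i j g *: L (word [:: T g])) +
         \sum_g kappa j i g *: L (word [:: T g]).
    rewrite scaler_sumr -big_split; apply: eq_bigr => g _ /=.
    by rewrite /c scalerDl scalerA addrC.
  by rewrite scalerBl scale1r mulrC addrAC addrA -e subrr.
split=> [|g]; first by apply/eqP; rewrite -subr_eq0 q0.
by apply/eqP; rewrite mulNr -addr_eq0; apply/eqP/c0.
Qed.

End Necessity.

(** * Quantum Drinfeld Hecke algebras *)

Lemma flatten_nseq_prod (S : pzRingType) (X I : Type) (phi : seq X -> S)
    (x : I -> X) (m : I -> nat) (s : seq I) :
  phi [::] = 1 -> (forall a b, phi (a ++ b) = phi a * phi b) ->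
  \prod_(i <- s) phi [:: x i] ^+ m i =
  phi (map x (flatten [seq nseq (m i) i | i <- s])).
Proof.
move=> phi1 phiM; elim: s => [|i s IH]; first by rewrite big_nil phi1.
rewrite big_cons IH /= map_cat phiM; congr (_ * _).
elim: (m i) => [|k IHk]; first by rewrite phi1.
by rewrite exprS IHk -phiM.
Qed.

Lemma free_subfamily (K : fieldType) (M : lmodType K) (I : choiceType)
    (b : I -> M) (J : finType) (P : pred J) (f : J -> I) (c : J -> K) :
  (forall (s : seq I) (c : I -> K), uniq s ->
     \sum_(i <- s) c i *: b i = 0 -> {in s, forall i, c i = 0}) ->
  {in P &, injective f} -> \sum_(j | P j) c j *: b (f j) = 0 ->
  forall j, P j -> c j = 0.
Proof.
move=> b_free f_inj sum0 j Pj.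
pose d i := \sum_(j | P j && (f j == i)) c j.
have dE k : P k -> d (f k) = c k.
  move=> Pk; rewrite /d (bigD1 k) ?Pk ?eqxx //= big1 ?addr0 // => k'.
  by case/andP => /andP[Pk' /eqP/f_inj ->] //; rewrite eqxx.
rewrite -dE //; apply: (b_free [seq f k | k <- enum P] d).
- rewrite map_inj_in_uniq ?enum_uniq // => k k'; rewrite !mem_enum.
  exact: f_inj.
- rewrite big_map big_enum /= -[RHS]sum0; apply: eq_bigr => k Pk.
  by rewrite dE.
- by apply: map_f; rewrite mem_enum.
Qed.

(** * Dependencies between the defining relations *)

Section RelationIdentities.
Variables (K : fieldType) (A : algType K) (n : nat).
Implicit Types (x : 'I_n -> A) (t : A).

Lemma mul_suml (c : 'I_n -> K) x t :
  (\sum_k c k *: x k) * t = \sum_k c k *: (x k * t).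
Proof. by rewrite mulr_suml; apply: eq_bigr => k _; rewrite scalerAl. Qed.

(** Reduces the action relation of a vector to those of the basis vectors. *)
Lemma action_relation_sum (c : 'I_n -> K) (e : 'I_n -> 'I_n -> K) x t :
  t * (\sum_i c i *: x i) - (\sum_k (\sum_i c i * e k i) *: x k) * t =
  \sum_i c i *: (t * x i - \sum_k e k i *: (x k * t)).
Proof.
under [RHS]eq_bigr do rewrite scalerBr.
rewrite sumrB; congr (_ - _).
  by rewrite mulr_sumr; apply: eq_bigr => i _; rewrite scalerAr.
rewrite mul_suml; under eq_bigr do rewrite scaler_suml.
rewrite exchange_big; apply: eq_bigr => i _ /=.
by rewrite scaler_sumr; apply: eq_bigr => k _; rewrite scalerA.
Qed.

Lemma comm_relation_swap (q q' : K) (x y s s' : A) :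
  q * q' = 1 -> s = - q *: s' ->
  y * x - (q *: (x * y) + s) = - q *: (x * y - (q' *: (y * x) + s')).
Proof.
move=> qq' ->; rewrite scalerBr scalerDr scalerA mulNr qq' !scaleNr scale1r.
by rewrite !opprD !opprK addrCA addrA.
Qed.

End RelationIdentities.

Section QuantumDrinfeldHecke.
Variables (K : fieldType) (V : vectType K) (n : nat) (v : n.-tuple V).
Variables (gT : finGroupType) (rho : gT -> 'End(V)) (Q : 'M[K]_n).
Variable kappa : 'I_n -> 'I_n -> {ffun gT -> K}.
Hypothesis v_basis : basis_of fullv v.
Hypothesis rho_rep : faithful_rep rho.

Local Notation letter := ('I_n + gT)%type.
Local Notation X i := (inl i : letter).
Local Notation T g := (inr g : letter).
Local Notation A := (freealg K letter).
Local Notation E := (rep_entry v rho).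
Local Notation rel := (qdh_rel v rho Q kappa).
Local Notation pbw_rule := (pbw_rule E Q (fun i j g => kappa i j g) (@word K letter)).

Lemma word2 (x y : letter) : word [:: x; y] = gen K x * gen K y.
Proof. by rewrite (word_cat _ [:: x]) !word1. Qed.

Lemma sum_coord_tuple (M : lmodType K) (x : 'I_n -> M) (i : 'I_n) :
  \sum_k coord v k v`_i *: x k = x i.
Proof.
rewrite (bigD1 i) //= coord_tuple // eqxx scale1r big1 ?addr0 // => k /negPf ki.
by rewrite coord_tuple // ki scale0r.
Qed.

Lemma pbw_rule_qdh l r : pbw_rule l r -> ideal_gen rel (word l - r).
Proof.
case=> [|g h|g i|i j ltij].
- by rewrite word1; apply/ideal_gen_rel/qdh_rel_one.
- by rewrite word2 word1; apply/ideal_gen_rel/qdh_rel_group.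
- have e1 : free_vect v gT v`_i = free_x K gT i by exact: sum_coord_tuple.
  have e2 : free_vect v gT (rho g v`_i) * free_t K n g =
      \sum_k E g k i *: word [:: X k; T g].
    apply: etrans (mul_suml _ _ _) _.
    by apply: eq_bigr => k _; rewrite word2.
  have := qdh_rel_act v rho Q kappa g v`_i.
  by rewrite word2 -e2 e1; apply: ideal_gen_rel.
- rewrite !word2; under eq_bigr do rewrite word1.
  exact/ideal_gen_rel/qdh_rel_comm.
Qed.

Definition rule_rel (x : A) : Prop :=
  exists l r, pbw_rule l r /\ x = word l - r.

Lemma rule_relP l r x : pbw_rule l r -> x = word l - r -> ideal_gen rule_rel x.
Proof. by move=> lr ->; apply: ideal_gen_rel; exists l, r. Qed.

(** The converse of [pbw_rule_qdh]. The relations with i > j and i = j are not rules;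
    [comm_relation_swap] derives the former, with its two premises supplied by (i) and (ii), and the
    latter vanish identically. *)
Lemma qdh_rel_pbw_rule : quantum_system Q -> quantum_2form Q kappa ->
  (forall i j, Q i j != 0) -> forall x, rel x -> ideal_gen rule_rel x.
Proof.
move=> [Q1 QV] [kappa0 kappaV] Q_neq0 x; case=> [|g h|g u|i j].
- by apply: (rule_relP (rule_one _ _ _ _)); rewrite word1.
- by apply: (rule_relP (rule_mul _ _ _ _ g h)); rewrite word2 word1.
- have -> : free_vect v gT (rho g u) =
      \sum_k (\sum_i coord v i u * E g k i) *: free_x K gT k.
    by apply: eq_bigr => k _; rewrite (coord_rho rho v_basis).
  have -> := action_relation_sum (fun i => coord v i u) (E g)
    (free_x K gT) (free_t K n g).
  apply: ideal_gen_sum => i; apply: ideal_genZ.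
  have e : \sum_k E g k i *: (free_x K gT k * free_t K n g) =
      \sum_k E g k i *: word [:: X k; T g].
    by apply: eq_bigr => k _; rewrite word2.
  apply: (rule_relP (rule_act _ _ _ _ g i)).
  exact: (congr2 (fun a b : A => a - b) (esym (word2 _ _)) e).
have ltP (i' j' : 'I_n) : (i' < j')%N -> ideal_gen rule_rel
   (free_x K gT j' * free_x K gT i' -
    (Q i' j' *: (free_x K gT i' * free_x K gT j') + free_kappa kappa i' j')).
  move=> ltij; apply: (rule_relP (rule_comm _ _ _ _ ltij)); rewrite !word2.
  by under [in RHS]eq_bigr do rewrite word1.
have [ltij|ltji|/val_inj <-] := ltngtP i j; first exact: ltP.
  rewrite (@comm_relation_swap _ _ _ (Q j i) _ _ _ (free_kappa kappa j i)).
  - exact/ideal_genZ/ltP.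
  - by rewrite QV mulVf.
  rewrite /free_kappa scaler_sumr; apply: eq_bigr => g _.
  rewrite kappaV; last by rewrite -val_eqE neq_ltn ltji orbT.
  by rewrite ffunE scalerA -QV.
rewrite Q1 scale1r /free_kappa kappa0 big1 ?addr0 ?subrr => [|g _].
  exact: ideal_gen_0.
by rewrite ffunE scale0r.
Qed.

Local Notation L := (quotmap rel).

Lemma qdh_word_cat a b : L (word (a ++ b)) = L (word a) * L (word b) :> qdh v rho Q kappa.
Proof. by rewrite word_cat -quot_mulE. Qed.

Lemma qdh_monomialE m g : qdh_monomial v rho Q kappa (m, g) =
  L (word (monomial_word (sorted_seq m) g)).
Proof.
rewrite qdh_word_cat word1; congr (_ * _).
pose phi w : qdh v rho Q kappa := L (word w).
transitivity (\prod_(i <- enum 'I_n) phi [:: X i] ^+ m i).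
  rewrite enumT -[Finite.enum _]/(index_enum 'I_n).
  by apply: eq_bigr => i _; rewrite /phi word1.
apply: flatten_nseq_prod; first by rewrite /phi word_nil.
exact: qdh_word_cat.
Qed.

Lemma pbw_rule_respects : respects word pbw_rule L (fun=> True).
Proof. exact: quotmap_respects (@word_cat K letter) pbw_rule_qdh. Qed.

Lemma coord_jacobi (g : gT) (i j k l : 'I_n) :
  coord v l (kappa i j g *: ((Q i k * Q j k) *: rho g v`_k - v`_k)
      + kappa i k g *: (Q j k *: v`_j - Q i j *: rho g v`_j)
      + kappa j k g *: (rho g v`_i - (Q i j * Q i k) *: v`_i)) =
  jacobi_coef E Q (fun i j g => kappa i j g) g i j k l.
Proof.
by rewrite !(linearD, linearN, linearZ) /= !coord_tuple.
Qed.

Lemma jacobi_vectorP (g : gT) (i j k : 'I_n) :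
  0 = kappa i j g *: ((Q i k * Q j k) *: rho g v`_k - v`_k)
      + kappa i k g *: (Q j k *: v`_j - Q i j *: rho g v`_j)
      + kappa j k g *: (rho g v`_i - (Q i j * Q i k) *: v`_i) <->
  forall l, jacobi_coef E Q (fun i j g => kappa i j g) g i j k l = 0.
Proof.
split=> [e l|coef0]; first by rewrite -coord_jacobi -e linear0.
symmetry; rewrite [LHS](vector_coordE v_basis) big1 // => l _.
by rewrite coord_jacobi coef0 scale0r.
Qed.

(** For independence, a relation in the quotient is lifted to the free algebra: it lies in the ideal
    of the rules, so the normal form map kills it, and distinct irreducible words are independent
    there. *)
Lemma pbw_sufficient : quantum_system Q -> quantum_2form Q kappa ->
  (forall i j, Q i j != 0) ->
  (forall h (i j : 'I_n), (i < j)%N -> forall k l : 'I_n, (k <= l)%N ->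
     straight_coef Q (minor E Q h i j) k l = 0) ->
  (forall g (i j k : 'I_n), (i < j)%N -> (j < k)%N -> forall l,
     jacobi_coef E Q (fun i j g => kappa i j g) g i j k l = 0) ->
  (forall g h (i j : 'I_n), (i < j)%N -> kappa i j (h^-1 * g * h)%g =
     \sum_(k < n) \sum_(l < n | (k < l)%N) minor E Q h i j k l * kappa k l g) ->
  is_quantum_Drinfeld_Hecke v rho Q kappa.
Proof.
move=> Qsys kappa2 Q_neq0 coef0 jacobi0 kappaJ.
pose lift (f : seq letter -> A) : {linear A -> A} := word_lift f.
have lift_word f w : lift f (word w) = f w by apply: word_lift_word.
have [N N_rule N_irr] := pbw_normal_form (word_nil K letter) (@word_cat K letter)
  (rep_entry1 v_basis rho_rep) (rep_entryM v_basis rho_rep) coef0 kappaJ jacobi0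
  lift_word.
pose L' : {linear A -> quotalg rel} := quotmap rel.
split=> [s c uniq_s sum0|x].
  apply: (normal_words_free (@word_cat K letter) lift_word _ N_irr uniq_s)
    => [a l r b lr _|].
    exact: N_rule.
  apply: (ideal_gen_linear0 (@freealg_word_span K letter) (R := rule_rel)).
    move=> a b r [l [r' [lr ->]]].
    exact: (respects_rule0 (@word_cat K letter) N_rule lr).
  apply: ideal_gen_sub (qdh_rel_pbw_rule Qsys kappa2 Q_neq0) _.
  rewrite -[\sum_(t <- s) _]subr0; apply/quotmapP; rewrite raddf0 -[RHS]sum0.
  rewrite -[LHS]/(L' _) linear_sum; apply: eq_bigr => -[m g] _.
  by rewrite linearZ /= qdh_monomialE.
rewrite -[x]quotmapK.
have [S eS] := normal_words_span (word_nil K letter) (@word_cat K letter)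
  (@freealg_word_span K letter) (L := L') pbw_rule_respects (repr x).
have [s [c es]] := spanning_family (fun t => L' (word (normal_word t.1 t.2))) S.
exists s, c; rewrite -[LHS]/(L' _) eS es; apply: eq_bigr => -[m g] _.
rewrite qdh_monomialE /=.
by rewrite (monomial_normal_word (@word_cat K letter) (L := L') pbw_rule_respects).
Qed.

Lemma pbw_necessary : (forall i j, Q i j != 0) ->
  is_quantum_Drinfeld_Hecke v rho Q kappa ->
  [/\ quantum_system Q,
      quantum_2form Q kappa,
      forall h (i j : 'I_n), (i < j)%N -> forall k l : 'I_n, (k <= l)%N ->
        straight_coef Q (minor E Q h i j) k l = 0,
      forall g (i j k : 'I_n), (i < j)%N -> (j < k)%N -> forall l,
        jacobi_coef E Q (fun i j g => kappa i j g) g i j k l = 0 &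
      forall g h (i j : 'I_n), (i < j)%N -> kappa i j (h^-1 * g * h)%g =
        \sum_(k < n) \sum_(l < n | (k < l)%N) minor E Q h i j k l * kappa k l g].
Proof.
move=> Q_neq0 [mono_free _].
pose L' : {linear A -> quotalg rel} := quotmap rel.
have L_free (J : finType) (P : pred J) (e : J -> seq 'I_n * gT) (c : J -> K) :
    (forall j, P j -> sorted (@ord_le n) (e j).1) -> {in P &, injective e} ->
    \sum_(j | P j) c j *: L' (word (monomial_word (e j).1 (e j).2)) = 0 ->
    forall j, P j -> c j = 0.
  move=> e_sorted e_inj sum0.
  (* Exponents are letter counts; [f] is injective because a sorted list is determined by its
     counts. *)
  pose f j := ([ffun i => count_mem i (e j).1] : {ffun 'I_n -> nat}, (e j).2).
  apply: (free_subfamily (f := f) mono_free).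
    move=> j j' Pj Pj' [e1 e2]; apply: e_inj => //.
    rewrite [e j]surjective_pairing [e j']surjective_pairing e2.
    by rewrite (sorted_seq_count (e_sorted j Pj)) e1 -sorted_seq_count ?e_sorted.
  rewrite -[RHS]sum0; apply: eq_bigr => j Pj.
  by rewrite qdh_monomialE -sorted_seq_count ?e_sorted.
have L_comm i j : L' (word [:: X j; X i]) = L' (Q i j *: word [:: X i; X j] +
    \sum_g kappa i j g *: word [:: T g]).
  apply/quotmapP; rewrite !word2; under eq_bigr do rewrite word1.
  exact/ideal_gen_rel/qdh_rel_comm.
have diag := pbw_relation_diag (@word_cat K letter) (L := L') pbw_rule_respects
  L_free L_comm.
have twice := pbw_relation_twice (@word_cat K letter) (L := L') pbw_rule_respects
  L_free L_comm.
have QQ i j : Q i j * Q j i = 1.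
  have [leij|/ltnW leji] := leqP i j; first exact: (twice i j leij).1.
  by rewrite mulrC; apply: (twice j i leji).1.
have QV i j : Q i j = (Q j i)^-1 by apply: (mulIf (Q_neq0 j i)); rewrite QQ mulVf.
split.
- by split=> // i; apply: (diag i).1.
- split=> [i|i j nij]; apply/ffunP => g; rewrite !ffunE; first exact: (diag i).2.
  have [leij|/ltnW leji] := leqP i j.
    by rewrite (twice i j leij).2 -QV scalerA mulNr mulrN opprK QQ scale1r.
  by rewrite (twice j i leji).2 -QV.
- move=> h i j ltij.
  exact: (pbw_straight_kappa (word_nil K letter) (@word_cat K letter) (L := L')
    pbw_rule_respects L_free h ltij).1.
- move=> g i j k ltij ltjk l.
  exact: (pbw_jacobi (word_nil K letter) (@word_cat K letter) (L := L')
    pbw_rule_respects L_free).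
- move=> g h i j ltij.
  exact: (pbw_straight_kappa (word_nil K letter) (@word_cat K letter) (L := L')
    pbw_rule_respects L_free h ltij).2.
Qed.

End QuantumDrinfeldHecke.

Theorem theorem7p6 (K : fieldType) (V : vectType K) (n : nat) (v : n.-tuple V)
    (gT : finGroupType) (rho : gT -> 'End(V)) (Q : 'M[K]_n)
    (kappa : 'I_n -> 'I_n -> {ffun gT -> K}) :
  basis_of fullv v ->
  faithful_rep rho ->
  (forall i j : 'I_n, Q i j != 0) ->
  is_quantum_Drinfeld_Hecke v rho Q kappa <->
  [/\ quantum_system Q /\ acts_on_qpoly v rho Q,
      quantum_2form Q kappa,
      forall (h : gT) (i j k : 'I_n), (i < j)%N -> (j < k)%N ->
        0 = kappa i j h *: ((Q i k * Q j k) *: rho h v`_k - v`_k)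
          + kappa i k h *: (Q j k *: v`_j - Q i j *: rho h v`_j)
          + kappa j k h *: (rho h v`_i - (Q i j * Q i k) *: v`_i)
    & forall (g h : gT) (i j : 'I_n), (i < j)%N ->
        kappa i j (h^-1 * g * h)%g =
        \sum_(k < n) \sum_(l < n | (k < l)%N)
           qminor v Q i j k l (rho h) * kappa k l g].
Proof.
move=> v_basis rho_rep Q_neq0.
have actP := acts_on_qpolyP Q v_basis rho_rep.
split=> [/(pbw_necessary v_basis Q_neq0)[Qsys kappa2 coef0 jacobi0 kappaJ]|].
  split=> //; first by split=> //; apply/actP.
  by move=> h i j k ltij ltjk; apply/jacobi_vectorP => // l; apply: jacobi0.
case=> -[Qsys /actP coef0] kappa2 jacobi0 kappaJ.
apply: pbw_sufficient => // g i j k ltij ltjk.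
by apply/jacobi_vectorP => //; apply: jacobi0.
Qed.
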